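(* Let $d,r\ge1$ be integers and $\alpha_1,\dots,\alpha_r\in\mathbb{R}^d$. Let $\xi_1,\dots,\xi_r$ be $\mathbb{Z}$-valued random variables and $I$ a $\{1,2,\dots,r\}$-valued random variable such that $\xi_1,\dots,\xi_r,I$ are independent, and let $\nu$ be the distribution of $\xi_I\alpha_I+\mathbb{Z}^d$ on $\mathbb{R}^d/\mathbb{Z}^d$, i.e. $$\nu=\sum_{i=1}^r\sum_{n\in\mathbb{Z}}\Pr(I=i)\Pr(\xi_i=n)\,\delta_{n\alpha_i+\mathbb{Z}^d}.$$ Let $\mu$ be the normalized Haar measure on $\mathbb{R}^d/\mathbb{Z}^d$. Assume that $\xi_1,\dots,\xi_r$ are nondegenerate, that $\Pr(I=i)>0$ for all $1\le i\le r$, and that $$K:=\inf_{\substack{h\in\mathbb{Z}^d\\ h\ne0}}\left(\max_{1\le i\le r}\|\langle h,\alpha_i\rangle\|_{\mathbb{R}/\mathbb{Z}}\cdot\psi(\|h\|_\infty)\right)>0$$ with a positive nondecreasing function $\psi$ on $[1,\infty)$ such that $\psi(x)x^{-d/r}$ is nondecreasing. Then there is a constant $C>0$, depending only on the distributions of $\xi_1,\dots,\xi_r,I$, the value of the infimum $K$, $d$ and $r$, such that for any integer $k\ge1$, $$W_1(\nu^{*k},\mu)\le\frac{C}{\psi^{-1}(\sqrt k)},$$ where $\psi^{-1}(y)=\sup\{x\ge1:\psi(x)\le y\}$ is the generalized inverse function of $\psi$.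
   Context: $\|\cdot\|_{\mathbb{R}/\mathbb{Z}}$ is the distance to the nearest integer; $\|h\|_\infty=\max_j|h_j|$; $\langle\cdot,\cdot\rangle$ is the usual scalar product on $\mathbb{R}^d$; $\delta_a$ is the Dirac measure at $a$. A random variable is nondegenerate if it is not almost surely constant. $\nu^{*k}$ is the $k$-fold convolution of $\nu$. The torus has the Euclidean metric $\|x-y\|_{\mathbb{R}^d/\mathbb{Z}^d}=\min_{m\in\mathbb{Z}^d}|x-y-m|$ ($|\cdot|$ the Euclidean norm), and $W_1(\nu_1,\nu_2)=\inf_\vartheta\int\|x-y\|_{\mathbb{R}^d/\mathbb{Z}^d}\,\mathrm{d}\vartheta(x,y)$, the infimum being over all Borel probability measures $\vartheta$ on $(\mathbb{R}^d/\mathbb{Z}^d)\times(\mathbb{R}^d/\mathbb{Z}^d)$ with marginals $\nu_1,\nu_2$. If the set $\{x\ge1:\psi(x)\le y\}$ is empty (i.e. contains no $x\ge 1$), its supremum, taken within $[1,\infty)$, is understood to be $1$. *)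

(* Defs.v *)
From HB Require Import structures.
From mathcomp Require Import all_boot all_order all_algebra.
From mathcomp Require Import all_classical all_reals all_analysis.
From mathcomp Require Import ring lra.

Set Implicit Arguments.
Unset Strict Implicit.
Unset Printing Implicit Defensive.

Import Order.TTheory GRing.Theory Num.Theory.
Import numFieldNormedType.Exports.

Local Open Scope classical_set_scope.
Local Open Scope ring_scope.
Local Open Scope quotient_scope.

Section EuclideanNorm.
Context {R : realType} {d : nat}.
Implicit Types u v : 'rV[R]_d.

Definition enorm u : R := Num.sqrt (\sum_(j < d) u 0 j ^+ 2).

Lemma enorm0 : enorm 0 = 0.
Proof. by rewrite /enorm big1 ?sqrtr0// => j _; rewrite mxE expr0n. Qed.

Lemma enormN u : enorm (- u) = enorm u.
Proof.
by rewrite /enorm; congr Num.sqrt; apply: eq_bigr => j _; rewrite mxE sqrrN.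
Qed.

Lemma enorm_ge0 u : 0 <= enorm u. Proof. exact: sqrtr_ge0. Qed.

Lemma sqr_enorm u : enorm u ^+ 2 = \sum_(j < d) u 0 j ^+ 2.
Proof. by rewrite sqr_sqrtr// sumr_ge0// => j _; exact: sqr_ge0. Qed.

Lemma ler_coord_enorm u j : `|u 0 j| <= enorm u.
Proof.
rewrite -sqrtr_sqr ler_sqrt; last by apply: sumr_ge0 => i _; exact: sqr_ge0.
by rewrite (bigD1 j)//= lerDl sumr_ge0// => i _; exact: sqr_ge0.
Qed.

Lemma enorm_cauchy_schwarz u v :
  \sum_(j < d) u 0 j * v 0 j <= enorm u * enorm v.
Proof.
have zero w : enorm w = 0 -> forall j, w 0 j = 0.
  move=> w0 j; apply/eqP; rewrite -normr_eq0 eq_le normr_ge0 andbT.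
  by rewrite -w0 ler_coord_enorm.
have [u0|u0] := eqVneq (enorm u) 0.
  by rewrite u0 mul0r big1// => j _; rewrite zero// mul0r.
have [v0|v0] := eqVneq (enorm v) 0.
  by rewrite v0 mulr0 big1// => j _; rewrite (zero v)// mulr0.
have uv0 : 0 < enorm u * enorm v by rewrite mulr_gt0// lt_def enorm_ge0 ?u0 ?v0.
rewrite -(ler_pM2l uv0) -(ler_pM2l (ltr0n R 2)) -subr_ge0.
set a := enorm u; set b := enorm v.
suff -> : 2 * (a * b * (a * b)) - 2 * (a * b * \sum_(j < d) u 0 j * v 0 j) =
    \sum_(j < d) (b * u 0 j - a * v 0 j) ^+ 2.
  by apply: sumr_ge0 => j _; exact: sqr_ge0.
transitivity (b ^+ 2 * (\sum_(j < d) u 0 j ^+ 2) +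
    a ^+ 2 * (\sum_(j < d) v 0 j ^+ 2) -
    2 * (a * b * \sum_(j < d) u 0 j * v 0 j)).
  by rewrite -!sqr_enorm -/a -/b; ring.
rewrite !mulr_sumr -big_split/= -sumrB; apply: eq_bigr => j _; ring.
Qed.

Lemma enormD u v : enorm (u + v) <= enorm u + enorm v.
Proof.
rewrite -(@ler_pXn2r _ 2)// ?nnegrE ?addr_ge0 ?enorm_ge0//.
rewrite sqr_enorm.
have -> : \sum_(j < d) (u + v) 0 j ^+ 2 =
    enorm u ^+ 2 + enorm v ^+ 2 + 2 * \sum_(j < d) u 0 j * v 0 j.
  rewrite !sqr_enorm mulr_sumr -!big_split/=; apply: eq_bigr => j _.
  rewrite mxE; ring.
rewrite sqrrD [leRHS]addrAC lerD2l -[leRHS]mulr_natl ler_pM2l//.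
exact: enorm_cauchy_schwarz.
Qed.

Lemma ler_coord_norm u j : `|u 0 j| <= `|u|.
Proof.
rewrite [leRHS]/Num.Def.normr/= mx_normrE.
by apply/bigmax_geP; right => /=; exists (0, j).
Qed.

Lemma enorm_le_norm u : enorm u <= d%:R * `|u|.
Proof.
rewrite -(@ler_pXn2r _ 2)// ?nnegrE ?enorm_ge0 ?mulr_ge0//.
rewrite sqr_enorm exprMn.
apply: (@le_trans _ _ (\sum_(j < d) `|u| ^+ 2)).
  apply: ler_sum => j _; rewrite -[leLHS]real_normK ?num_real// ler_pXn2r ?nnegrE//.
  exact: ler_coord_norm.
rewrite sumr_const card_ord -[leLHS]mulr_natl ler_wpM2r ?sqr_ge0//.
by rewrite -natrX ler_nat; case: (d) => // n; rewrite expnS leq_pmulr.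
Qed.

End EuclideanNorm.

Section Lattice.
Variables (R : realType) (d : nat).

Definition int_vect : {pred 'rV[R]_d} := fun u => [forall j, u 0 j \is a Num.int].

Lemma int_vect_zmod_closed : zmod_closed int_vect.
Proof.
split=> [|u v /forallP uZ /forallP vZ]; apply/forallP => j.
  by rewrite mxE rpred0.
by rewrite !mxE rpredB.
Qed.

HB.instance Definition _ :=
  GRing.isZmodClosed.Build 'rV[R]_d int_vect int_vect_zmod_closed.

Lemma int_vectP u :
  reflect (exists m : 'rV[int]_d, u = map_mx intr m) (u \in int_vect).
Proof.
apply: (iffP forallP) => [uZ|[m ->] j]; last by rewrite mxE intr_int.
exists (\row_j Num.floor (u 0 j)); apply/rowP => j.
by rewrite !mxE; apply/esym/eqP; rewrite -intrEfloor.
Qed.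

End Lattice.

Definition torus (R : realType) (d : nat) : Type := {ideal_quot (@int_vect R d)}.

HB.instance Definition _ R d := EqQuotient.on (torus R d).
HB.instance Definition _ R d := GRing.Zmodule.on (torus R d).
HB.instance Definition _ R d := isPointed.Build (torus R d) 0.

Section TorusMetric.
Variables (R : realType) (d : nat).
Local Notation T := (torus R d).
Implicit Types (x y z : T) (u v w : 'rV[R]_d).

Lemma pi_torusD u v : \pi_T (u + v) = \pi_T u + \pi_T v.
Proof. exact: raddfD. Qed.

Lemma pi_torusN u : \pi_T (- u) = - \pi_T u.
Proof. exact: raddfN. Qed.

Lemma pi_torusB u v : \pi_T (u - v) = \pi_T u - \pi_T v.
Proof. exact: raddfB. Qed.

Lemma pi_torus0 : \pi_T 0 = 0.
Proof. exact: raddf0. Qed.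

Lemma pi_torus_eq u v :
  \pi_T u = \pi_T v <-> exists m : 'rV[int]_d, v = u - map_mx intr m.
Proof.
have uvE : (u - v \in @int_vect R d) = (\pi_T u == \pi_T v).
  exact: Quotient.idealrBE.
split=> [uv|[m vE]].
  have /int_vectP[m uvm] : u - v \in @int_vect R d by rewrite uvE; apply/eqP.
  by exists m; rewrite -uvm opprB addrC subrK.
apply/eqP; rewrite -[_ == _]uvE vE opprB addrC subrK.
by apply/int_vectP; exists m.
Qed.

(* The minimum over m of |x - y - m|, written as an infimum; by torus_distE it
   does not depend on the representatives. *)
Definition torus_dist x y : R :=
  inf [set enorm (repr x - repr y - map_mx intr m) | m in [set: 'rV[int]_d]].

Lemma torus_distE x y :
  torus_dist x y = inf [set enorm w | w in [set w | \pi_T w = x - y]].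
Proof.
congr inf; apply/seteqP; split=> [_ [m _ <-]|_ [w /= wxy <-]].
  exists (repr x - repr y - map_mx intr m) => //=.
  rewrite -[in RHS](reprK x) -[in RHS](reprK y) -pi_torusB.
  by apply/esym/pi_torus_eq; exists m.
have : \pi_T (repr x - repr y) = \pi_T w by rewrite pi_torusB !reprK.
by case/pi_torus_eq => m ->; exists m.
Qed.

Lemma torus_dist_le x y w : \pi_T w = x - y -> torus_dist x y <= enorm w.
Proof.
move=> wxy; rewrite torus_distE; apply: ge_inf; last by exists w.
by exists 0 => _ [v _ <-]; exact: enorm_ge0.
Qed.

Lemma torus_dist_lb x y c : (forall w, \pi_T w = x - y -> c <= enorm w) ->
  c <= torus_dist x y.
Proof.
move=> lb; rewrite torus_distE; apply: lb_le_inf.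
  exists (enorm (repr x - repr y)), (repr x - repr y) => //=.
  by rewrite pi_torusB !reprK.
by move=> _ [w /= wxy <-]; exact: lb.
Qed.

Lemma torus_dist_adherent x y e : 0 < e ->
  exists2 w, \pi_T w = x - y & enorm w < torus_dist x y + e.
Proof.
move=> e0; apply: contrapT => /forall2NP H.
suff : torus_dist x y + e <= torus_dist x y by rewrite gerDl leNgt e0.
apply: torus_dist_lb => w wxy; have [//|/negP] := H w.
by rewrite -leNgt.
Qed.

Lemma torus_dist_ge0 x y : 0 <= torus_dist x y.
Proof. by apply: torus_dist_lb => w _; exact: enorm_ge0. Qed.

Lemma torus_distxx x : torus_dist x x = 0.
Proof.
apply/eqP; rewrite eq_le torus_dist_ge0 andbT -[leRHS](@enorm0 R d).
by apply: torus_dist_le; rewrite subrr pi_torus0.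
Qed.

Lemma torus_dist_sym x y : torus_dist x y = torus_dist y x.
Proof.
suff le a b : torus_dist a b <= torus_dist b a by apply/eqP; rewrite eq_le !le.
apply: torus_dist_lb => w wba; rewrite -enormN; apply: torus_dist_le.
by rewrite pi_torusN wba opprB.
Qed.

Lemma torus_dist_add x y x' y' :
  torus_dist (x + x') (y + y') <= torus_dist x y + torus_dist x' y'.
Proof.
apply/ler_addgt0Pl => e e0.
have e20 : 0 < e / 2 by rewrite divr_gt0.
have [w wE wlt] := torus_dist_adherent x y e20.
have [w' w'E w'lt] := torus_dist_adherent x' y' e20.
have ww' : torus_dist (x + x') (y + y') <= enorm (w + w').
  by apply: torus_dist_le; rewrite pi_torusD wE w'E opprD addrACA.
by have := enormD w w'; lra.
Qed.

Lemma torus_dist_triangle y x z :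
  torus_dist x z <= torus_dist x y + torus_dist y z.
Proof.
have := torus_dist_add (x - y) 0 y z.
have -> : torus_dist (x - y) 0 = torus_dist x y.
  by rewrite !torus_distE subr0.
by rewrite subrK add0r.
Qed.

Lemma torus_dist_positivity x y : torus_dist x y = 0 -> x = y.
Proof.
move=> xy0; apply/eqP; rewrite -subr_eq0; apply/negPn/negP => xy.
have [u uxy] : exists u, \pi_T u = x - y by exists (repr (x - y)); rewrite reprK.
have /existsP[j uj] : [exists j, u 0 j \isn't a Num.int].
  rewrite -negb_forall; apply: contra xy => uZ; rewrite -uxy -pi_torus0.
  by rewrite -Quotient.idealrBE subr0.
have fl := Num.Theory.floor_le (u 0 j).
have fl1 := Num.Theory.floorD1_gt (u 0 j).
have {}fl : (Num.floor (u 0 j))%:~R < u 0 j.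
  by rewrite lt_def fl andbT; apply: contra uj => /eqP ->; rewrite intr_int.
pose c := Num.min (u 0 j - (Num.floor (u 0 j))%:~R)
                  ((Num.floor (u 0 j) + 1)%:~R - u 0 j).
have c0 : 0 < c by rewrite lt_min !subr_gt0 fl fl1.
suff : c <= torus_dist x y by rewrite xy0 leNgt c0.
apply: torus_dist_lb => w; rewrite -uxy => /esym/pi_torus_eq[m ->].
apply: le_trans (ler_coord_enorm _ j).
rewrite !mxE ge_min; apply/orP.
have [mf|fm] := lerP (m 0 j) (Num.floor (u 0 j)); [left|right].
  by rewrite (le_trans _ (ler_norm _))// lerD2l lerN2 ler_int.
by rewrite distrC (le_trans _ (ler_norm _))// lerD2r ler_int lezD1.
Qed.

HB.instance Definition _ := @isMetric.Build R T
  torus_dist torus_distxx torus_dist_positivity torus_dist_sym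
  torus_dist_triangle.

Lemma mdist_torusE x y : mdist x y = torus_dist x y. Proof. by []. Qed.


(* Borel sigma-algebra of the metric topology *)
HB.instance Definition _ := @isMeasurable.Build
  (sigma_display (@open T)) T <<s @open T >>
  (@sigma_algebra0 _ setT _) (@sigma_algebraC _ _)
  (@sigma_algebra_bigcup _ setT _).

Lemma pi_torus_continuous : continuous (\pi_T : 'rV[R]_d -> T).
Proof.
move=> u A /nbhs_ballP[e /= e0 eA].
have d0 : 0 < d%:R + 1 :> R by rewrite ltr_wpDl.
apply/nbhs_ballP; exists (e / (d%:R + 1)); first exact: divr_gt0.
move=> v; rewrite -ball_normE/= ltr_pdivlMr// mulrC => uv.
apply: eA; rewrite ballEmdist/= mdist_torusE.
apply: (@le_lt_trans _ _ (enorm (u - v))).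
  by apply: torus_dist_le; rewrite pi_torusB.
apply: (le_lt_trans (enorm_le_norm _)); apply: le_lt_trans uv.
by rewrite ler_wpM2r// lerDl.
Qed.

Lemma torus_compact : compact [set: T].
Proof.
suff -> : [set: T] =
    (\pi_T : _ -> T) @` [set v : 'rV[R]_d | forall j, `[0, 1]%classic (v ord0 j)].
  apply: continuous_compact; last first.
    apply: (@rV_compact R d (fun=> `[0, 1]%classic)) => _; exact: segment_compact.
  by apply: continuous_subspaceT => u; exact: pi_torus_continuous.
apply/seteqP; split=> // x _.
exists (repr x - map_mx intr (\row_j Num.floor (repr x 0 j))).
  move=> j; rewrite /= !mxE in_itv/= subr_ge0 floor_le/= lerBlDr.
  by rewrite addrC -intrD1 ltW// floorD1_gt.
rewrite -[RHS]reprK; apply/esym/pi_torus_eq.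
by exists (\row_j Num.floor (repr x 0 j)).
Qed.

Lemma open_measurable_torusX (W : set (T * T)) : open W -> measurable W.
Proof.
have [B cB [Bopen Bbasis]] := compact_second_countable torus_compact => oW.
pose I := [set b : set T * set T | [/\ B b.1, B b.2 & b.1 `*` b.2 `<=` W]].
have -> : W = \bigcup_(b in I) (b.1 `*` b.2).
  apply/seteqP; split=> [[x y] /= Wxy|z [b [_ _ bW] /bW//]].
  have /nbhs_ballP[e /= e0 eW] : nbhs (x, y) W by exact: open_nbhs_nbhs.
  have [U [BU Ux] Ue] := Bbasis x (ball x e) (nbhsx_ballx _ _ e0).
  have [V [BV Vy] Ve] := Bbasis y (ball y e) (nbhsx_ballx _ _ e0).
  exists (U, V) => //; split=> // -[a b] [/= Ua Vb]; apply: eW.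
  by split; [exact: Ue|exact: Ve].
have cI : countable I.
  apply: (@sub_countable _ _ _ (B `*` B)); last exact: countableX.
  by apply: subset_card_le => b [].
rewrite bigcup_set_type; apply: countable_bigcupT_measurable.
  by rewrite (eq_countable (card_setT _)).
move=> [b /= /set_mem[Bb1 Bb2 _]]; apply: measurableX.
  by apply: sub_sigma_algebra; exact: Bopen.
by apply: sub_sigma_algebra; exact: Bopen.
Qed.

(* The product sigma-algebra is the Borel sigma-algebra of the product. *)
Lemma measurable_torusX : @measurable _ (T * T)%type = <<s @open (T * T)%type >>.
Proof.
apply/seteqP; split; last first.
  apply: smallest_sub; last exact: open_measurable_torusX.
  exact: sigma_algebra_measurable.
pose B2 := g_sigma_algebraType (@open (T * T)%type).
have mproj (f : T * T -> T) : continuous f -> measurable_fun setT (f : B2 -> T).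
  move=> /continuousP cf.
  apply: (@measurability _ _ B2 T _ _ (@open T)) => // _ [A oA <-].
  by rewrite setTI; apply: sub_sigma_algebra; exact: cf.
rewrite measurable_prod_measurableType; apply: smallest_sub.
  exact: (@sigma_algebra_measurable _ B2).
move=> _ [A mA [B mB <-]].
have mfst : measurable_fun setT (fst : B2 -> T).
  by apply: mproj => z; exact: cvg_fst.
have msnd : measurable_fun setT (snd : B2 -> T).
  by apply: mproj => z; exact: cvg_snd.
have := @measurableI _ B2 _ _ (mfst measurableT A mA) (msnd measurableT B mB).
by rewrite !setTI.
Qed.

Definition torus_add (z : T * T) : T := z.1 + z.2.

Lemma measurable_torus_add : measurable_fun setT torus_add.
Proof.
apply: (@measurability _ _ _ _ _ _ (@open T)) => // _ [W oW <-].
rewrite setTI; apply: open_measurable_torusX.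
rewrite openE => -[x y] Wxy.
have /nbhs_ballP[e /= e0 eW] : nbhs (x + y) W by exact: open_nbhs_nbhs.
apply/nbhs_ballP; exists (e / 2); first by rewrite /= divr_gt0.
move=> [a b] [/=]; rewrite !ballEmdist/= !mdist_torusE => xa yb; apply: eW.
rewrite ballEmdist/= mdist_torusE.
by apply: (le_lt_trans (torus_dist_add _ _ _ _)); lra.
Qed.

HB.instance Definition _ :=
  isMeasurableFun.Build _ _ _ _ torus_add measurable_torus_add.

End TorusMetric.

HB.instance Definition _ := isPointed.Build int 0.
HB.instance Definition _ := @isMeasurable.Build default_measure_display
  int discrete_measurable discrete_measurable0
  discrete_measurableC discrete_measurableU.

HB.instance Definition _ n := isPointed.Build 'I_n.+1 ord0.
HB.instance Definition _ n := @isMeasurable.Build default_measure_display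
  'I_n.+1 discrete_measurable discrete_measurable0
  discrete_measurableC discrete_measurableU.

Section TorusMeasures.
Variables (R : realType) (d : nat).
Local Notation T := (torus R d).
Implicit Types nu mu : probability T R.

Definition torus_conv nu1 nu2 : probability T R :=
  distribution (nu1 \x nu2)%E (@torus_add R d).

Definition torus_conv_pow nu (k : nat) : probability T R :=
  iter k (torus_conv nu) (dirac (0 : T)).

(* Normalization is part of the type of mu, and a finite Borel measure on a
   compact metric space is automatically regular, so this determines mu. *)
Definition is_haar mu : Prop :=
  forall (a : T) (A : set T), measurable A -> mu [set a + x | x in A] = mu A.

Definition coupling nu1 nu2 : set (probability (T * T)%type R) :=
  [set theta : probability (T * T)%type R |
    (forall A, measurable A -> pushforward theta fst A = nu1 A) /\
    (forall A, measurable A -> pushforward theta snd A = nu2 A)].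

Definition wasserstein1 nu1 nu2 : \bar R :=
  ereal_inf [set (\int[theta]_z (mdist z.1 z.2)%:E)%E |
    theta in coupling nu1 nu2].

End TorusMeasures.

Definition mutually_independent disp (Omega : measurableType disp)
    (R : realType) (P : probability Omega R) (J : finType)
    (F : J -> set_system Omega) : Prop :=
  forall (S : {set J}) (E : J -> set Omega), (forall j, j \in S -> F j (E j)) ->
    P (\bigcap_(j in [set` S]) E j) = (\prod_(j in S) P (E j))%E.

(* There are r.+1 >= 1 random variables: the value type of I has to be nonempty
   to carry a measurable structure. *)
Section RandomStep.
Context {disp : measure_display} {Omega : measurableType disp} {R : realType}.
Context {P : probability Omega R} {d r : nat}.
Variables (alpha : 'I_r.+1 -> 'rV[R]_d).
Variables (xi : 'I_r.+1 -> {RV P >-> int}) (I : {RV P >-> 'I_r.+1}).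

Definition independent_family : Prop :=
  mutually_independent P (fun j : option 'I_r.+1 =>
    if j is Some i then g_sigma_algebra_preimage (xi i)
    else g_sigma_algebra_preimage I).

Definition random_step (w : Omega) : torus R d :=
  \pi_(torus R d) (alpha (I w) *~ xi (I w) w).

Lemma measurable_random_step : measurable_fun setT random_step.
Proof.
move=> _ A mA; rewrite setTI.
have -> : random_step @^-1` A = \bigcup_i
    ((I @^-1` [set i]) `&`
     (xi i @^-1` [set n | A (\pi_(torus R d) (alpha i *~ n))])).
  by apply/seteqP; split=> [w Aw|w [i _ [/= <-]]//]; exists (I w).
apply: countable_bigcupT_measurable => [|i]; first exact: countableP.
apply: measurableI.
  by rewrite -[X in measurable X]setTI; exact: measurable_funPT.
by rewrite -[X in measurable X]setTI; exact: measurable_funPT.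
Qed.

HB.instance Definition _ :=
  isMeasurableFun.Build _ _ _ _ random_step measurable_random_step.

End RandomStep.

Section Diophantine.
Context {R : realType} {d r : nat}.

Definition dist_int (x : R) : R := inf [set `|x - n%:~R| | n in [set: int]].

Definition dotp (h : 'rV[int]_d) (a : 'rV[R]_d) : R :=
  \sum_(j < d) (h 0 j)%:~R * a 0 j.

Definition supnorm (h : 'rV[int]_d) : R :=
  \big[Num.max/0]_(j < d) `|(h 0 j)%:~R|.

Definition diophantine_inf (alpha : 'I_r.+1 -> 'rV[R]_d) (psi : R -> R) : R :=
  inf [set (\big[Num.max/0]_(i < r.+1) dist_int (dotp h (alpha i))) *
           psi (supnorm h) | h in [set h : 'rV[int]_d | h != 0]].

End Diophantine.

(* The added point 1 makes the supremum 1 when the set is empty, and changes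
   nothing otherwise. *)
Definition gen_inverse (R : realType) (psi : R -> R) (y : R) : R :=
  sup (1 |` [set x | 1 <= x /\ psi x <= y]).

(* Main.v *)
From HB Require Import structures.
Require Import Defs.
From mathcomp Require Import all_boot all_order all_algebra.
From mathcomp Require Import all_classical all_reals all_analysis measurable_realfun.
From mathcomp Require Import ring lra zify.

(** By Kantorovich duality ([kantorovich_le]) it is enough to compare the
    integrals of a Lipschitz function f against the k-fold convolution of nu
    and against mu. Write |hat nu(h)|^2 for [fourier_sq nu h].

    Smoothing. Averaging f against the Fejer-Korovkin kernel of degree less
    than n moves f by O(1/n) uniformly and produces a trigonometric
    polynomial. Along n = 2^l, two consecutive averages differ by a
    trigonometric polynomial of sup norm O(2^-l), and Parseval with
    Cauchy-Schwarz bounds the discrepancy of this difference by 2^-l times the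
    square root of the energy of the measure, the sum of |hat nu(h)|^2 over
    0 < |h| <= 2^(l+1). Telescoping gives [berry_esseen_smoothing].

    Decay. A nondegenerate integer law has two atoms a <> b, so
    1 - |hat nu(h)|^2 >= c ||(a - b) <h, alpha_i>||^2. The factor a - b is
    unavoidable, since xi_i may live on a coset of a proper subgroup of Z. With
    Q a common multiple of the differences,
    |hat nu(h)|^(2k) <= exp (- c k max_i ||<Q h, alpha_i>||^2), and the
    Diophantine hypothesis is used at the frequency Q h.

    Counting. The Diophantine hypothesis at Q (h - h') says that the points
    (<Q h, alpha_i>)_i with |h| <= n are delta-separated modulo 1, where
    delta = K / psi (2 Q n). As soon as k delta^2 is bounded below, a Gaussian
    sum over separated points is comparable to its largest possible term, so
    the energy is O(exp (- c k delta^2)) for another constant c, with no loss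
    for the n^d frequencies ([separated_sum_le], [frequency_sum_le]).

    Scales. Let X be the generalized inverse of psi at sqrt k and x = X / 2, so
    that psi x <= sqrt k. The growth condition on psi turns k delta^2 into at
    least K^2 (x / (2 Q n))^(2 d / r.+1); the exponential then beats every power of
    n / x ([energy_le]), and the dyadic sum up to n of order x is O(1/x)
    ([wasserstein_conv_pow_le]). *)

Set Implicit Arguments.
Unset Strict Implicit.
Unset Printing Implicit Defensive.

Import Order.TTheory GRing.Theory Num.Theory.
Import numFieldNormedType.Exports.

Local Open Scope classical_set_scope.
Local Open Scope ring_scope.

(** * Linear programming duality and finite transport *)

Lemma eq_ler (R : numDomainType) (x y : R) : x = y -> x <= y.
Proof. by move=> ->. Qed.

Section Farkas.
Variables (R : realFieldType) (V : lmodType R).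

Definition linear_form (a : V -> R) := forall k u v, a (k *: u + v) = k * a u + a v.

Lemma linear_form0 a : linear_form a -> a 0 = 0.
Proof. by move=> la; have := la 1 0 0; rewrite scaler0 addr0 => ?; lra. Qed.

Lemma linear_formZ a k u : linear_form a -> a (k *: u) = k * a u.
Proof. by move=> la; rewrite -[k *: u]addr0 la linear_form0// addr0. Qed.

(** Induction on the number of constraints. If [c] is positive at some [x0]
    of the cone cut out by the first [m] forms, then [a m x0 > 0]; subtracting
    multiples of [a m] makes every form vanish at [x0] and leaves [m]
    constraints. *)
Lemma farkas_nat (m : nat) (a : nat -> V -> R) (c : V -> R) :
  (forall i, linear_form (a i)) -> linear_form c ->
  (forall x, (forall i, (i < m)%N -> a i x <= 0) -> c x <= 0) ->
  exists2 l : nat -> R, (forall i, 0 <= l i) &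
    forall x, c x = \sum_(i < m) l i * a i x.
Proof.
elim: m => [|m IH] in a c *.
  move=> la lc H; exists (fun=> 0) => // x; rewrite big_ord0.
  have c0 y : c y <= 0 by exact: H.
  have := c0 (- x); rewrite -scaleN1r linear_formZ// => ?.
  by have := c0 x; lra.
move=> la lc H.
have [[x0 [x0m cx0]]|Hm] :=
    pselect (exists x, (forall i, (i < m)%N -> a i x <= 0) /\ 0 < c x); last first.
  have [|l l0 lE] := IH a c la lc.
    by move=> x xm; rewrite leNgt; apply/negP => cx; apply: Hm; exists x.
  exists (fun i => if (i < m)%N then l i else 0) => [i|x]; first by case: ifP.
  rewrite big_ord_recr/= ltnn mul0r addr0 lE.
  by apply: eq_bigr => i _; rewrite ltn_ord.
have am0 : 0 < a m x0.
  rewrite ltNge; apply/negP => am; suff : c x0 <= 0 by rewrite leNgt cx0.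
  by apply: H => i; rewrite ltnS leq_eqVlt => /predU1P[->//|/x0m].
pose e b x := b x - b x0 / a m x0 * a m x.
have le b : linear_form b -> linear_form (e b).
  by move=> lb k u v; rewrite /e lb la; ring.
have eE b x : linear_form b -> e b x = b (- (a m x / a m x0) *: x0 + x).
  by move=> lb; rewrite lb /e; ring.
have [|||l l0 lE] := IH (e \o a) (e c); [by move=> i; exact: le|exact: le| |].
  move=> x /= xm; rewrite eE//; apply: H => i.
  rewrite ltnS leq_eqVlt => /predU1P[->|/xm]; last by rewrite eE.
  by rewrite la mulNr divfK ?gt_eqF// addNr.
(* This is the multiplier of the last form that makes both sides agree at x0. *)
pose lm := (c x0 - \sum_(i < m) l i * a i x0) / a m x0.
exists (fun i => if (i < m)%N then l i else lm) => [i|x].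
  case: ifP => // _; apply: divr_ge0; last exact: ltW.
  rewrite subr_ge0 (le_trans _ (ltW cx0))// sumr_le0// => j _.
  by rewrite mulr_ge0_le0// x0m.
rewrite big_ord_recr/= ltnn.
under eq_bigr => i _ do rewrite ltn_ord.
have := lE x; rewrite /e/= => /eqP; rewrite subr_eq => /eqP ->.
under eq_bigr => i _ do rewrite mulrBr.
rewrite sumrB -addrA; congr (_ + _).
rewrite /lm mulrBl mulrBl addrC; congr (_ - _).
by rewrite !mulr_suml; apply: eq_bigr => i _; rewrite !mulrA.
Qed.

Lemma farkas (I : finType) (a : I -> V -> R) (c : V -> R) :
  (forall i, linear_form (a i)) -> linear_form c ->
  (forall x, (forall i, a i x <= 0) -> c x <= 0) ->
  exists2 l : I -> R, (forall i, 0 <= l i) &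
    forall x, c x = \sum_i l i * a i x.
Proof.
move=> la lc H.
pose a' n : V -> R := if insub n is Some k then a (enum_val (k : 'I_#|I|)) else fun=> 0.
have a'E (k : 'I_#|I|) : a' k = a (enum_val k) by rewrite /a' valK.
have [|||l l0 lE] := @farkas_nat #|I| a' c.
- by move=> n k u v; rewrite /a'; case: insubP => [? _ _|_]; rewrite ?la// mulr0 addr0.
- by [].
- move=> x xI; apply: H => i; have := xI _ (ltn_ord (enum_rank i)).
  by rewrite a'E enum_rankK.
exists (fun i => l (enum_rank i)) => // x; rewrite lE.
rewrite (reindex (@enum_rank I))/=; last exact: onW_bij (@enum_rank_bij I).
by apply: eq_bigr => i _; rewrite a'E enum_rankK.
Qed.

End Farkas.

Section FiniteTransport.
Variables (R : realFieldType) (n : nat).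

Lemma finite_argmin (F : 'I_n.+1 -> R) : exists i, forall j, F i <= F j.
Proof.
have [i _ iP] := @arg_minP _ _ _ ord0 xpredT F isT; exists i => j; exact: iP.
Qed.

(** Farkas' lemma on triples (f, g, t): the constraints
    [f i + g j <= t * D i j] dualize to a transport plan, and the coordinate t
    makes them homogeneous. The hypothesis applies because f and - g are
    separated by the c-transform [h i] = min over j of [t * D i j - g j], which
    is t-Lipschitz. *)
Lemma finite_transport (D : 'I_n.+1 -> 'I_n.+1 -> R) (a b : 'I_n.+1 -> R) (c : R) :
  (forall i, D i i = 0) -> (forall i j k, D i k <= D i j + D j k) ->
  (forall i, 0 <= a i) -> (forall i, 0 <= b i) ->
  (forall t h, 0 <= t -> (forall i j, h i - h j <= t * D i j) ->
     \sum_i h i * a i - \sum_i h i * b i <= c * t) ->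
  exists l : 'I_n.+1 -> 'I_n.+1 -> R,
    [/\ forall i j, 0 <= l i j, forall i, \sum_j l i j = a i,
        forall j, \sum_i l i j = b j & \sum_i \sum_j l i j * D i j <= c].
Proof.
move=> D0 Dtri a0 b0 H.
pose V := ('rV[R]_n.+1 * 'rV[R]_n.+1 * R^o)%type.
pose A (o : option ('I_n.+1 * 'I_n.+1)) (v : V) : R :=
  if o is Some (i, j) then v.1.1 0 i + v.1.2 0 j - D i j * v.2 else - v.2.
pose C (v : V) : R := \sum_i v.1.1 0 i * a i + \sum_j v.1.2 0 j * b j - c * v.2.
have lA o : linear_form (A o).
  by case: o => [[i j]|] k u v; rewrite /A/= ?mxE; rewrite /GRing.scale/=; ring.
have lC : linear_form C.
  move=> k u v; rewrite /C/= /GRing.scale/=.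
  have E (x y : 'rV[R]_n.+1) w : \sum_i (k *: x + y) 0 i * w i =
      k * (\sum_i x 0 i * w i) + \sum_i y 0 i * w i.
    by rewrite mulr_sumr -big_split/=; apply: eq_bigr => i _; rewrite !mxE; ring.
  rewrite !E; ring.
have [v Hv|l l0 lE] := farkas lA lC.
  have t0 : 0 <= v.2 by have := Hv None; rewrite /A; lra.
  have fg i j : v.1.1 0 i + v.1.2 0 j <= v.2 * D i j.
    by have := Hv (Some (i, j)); rewrite /A; lra.
  have /choice[p pP] i := finite_argmin (fun j => v.2 * D i j - v.1.2 0 j).
  pose h i := v.2 * D i (p i) - v.1.2 0 (p i).
  have hf i : v.1.1 0 i <= h i by have := fg i (p i); rewrite /h; lra.
  have hg i : h i <= - v.1.2 0 i by have := pP i i; rewrite /h D0; lra.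
  have hl i j : h i - h j <= v.2 * D i j.
    have := pP i (p j); have := ler_wpM2l t0 (Dtri i j (p j)).
    rewrite /h mulrDr; lra.
  have := H _ _ t0 hl; rewrite /C.
  have : \sum_i v.1.1 0 i * a i <= \sum_i h i * a i.
    by apply: ler_sum => i _; rewrite ler_wpM2r.
  have : \sum_i v.1.2 0 i * b i <= \sum_i - (h i * b i).
    by apply: ler_sum => i _; rewrite -mulNr ler_wpM2r// lerNr.
  by rewrite sumrN; lra.
have lS v : C v = l None * - v.2 +
    \sum_i \sum_j l (Some (i, j)) * (v.1.1 0 i + v.1.2 0 j - D i j * v.2).
  rewrite lE (bigD1 None)//=; congr (_ + _).
  rewrite pair_big/= (reindex_omap Some id) => [|[[i j]|]]//=.
  by apply: eq_big => [[i j]|[i j] _]; rewrite /= ?eqxx.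
have delta_sum (w : 'I_n.+1 -> R) i :
    \sum_j (delta_mx 0 i : 'rV[R]_n.+1) 0 j * w j = w i.
  rewrite (bigD1 i)//= big1 => [|j ji]; rewrite !mxE eqxx ?eqxx ?mul1r ?addr0//=.
  by rewrite (negbTE ji) mul0r.
have zero_sum (w : 'I_n.+1 -> R) : \sum_j (0 : 'rV[R]_n.+1) 0 j * w j = 0.
  by rewrite big1// => j _; rewrite mxE mul0r.
exists (fun i j => l (Some (i, j))); split=> //.
- move=> i; have Ci : C (delta_mx 0 i, 0, 0) = a i.
    by rewrite /C/= delta_sum zero_sum mulr0 subr0 addr0.
  rewrite -Ci lS/= oppr0 mulr0 add0r exchange_big/=; apply: eq_bigr => j _.
  rewrite -[LHS](delta_sum (fun k => l (Some (k, j)))); apply: eq_bigr => k _.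
  by rewrite (mxE _ _ 0 j) mulr0 subr0 addr0 mulrC.
- move=> j; have Cj : C (0, delta_mx 0 j, 0) = b j.
    by rewrite /C/= delta_sum zero_sum mulr0 subr0 add0r.
  rewrite -Cj lS/= oppr0 mulr0 add0r; apply: eq_bigr => i _.
  rewrite -[LHS](delta_sum (fun k => l (Some (i, k)))); apply: eq_bigr => k _.
  by rewrite (mxE _ _ 0 i) mulr0 subr0 add0r mulrC.
- have C1 : C (0, 0, 1) = - c by rewrite /C/= !zero_sum mulr1 addr0 add0r.
  have : - c = - l None - \sum_i \sum_j l (Some (i, j)) * D i j.
    rewrite -C1 lS/= mulrN1 -sumrN; congr (_ + _); apply: eq_bigr => i _.
    rewrite -sumrN; apply: eq_bigr => j _.
    by rewrite !mxE addr0 sub0r mulr1 mulrN.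
  by have := l0 None; lra.
Qed.

End FiniteTransport.

(** * Couplings with prescribed masses on cells *)

Section CellCoupling.
Context disp (T : measurableType disp) (R : realType).
Variables (nu mu : probability T R) (n : nat).

(** The product measure is reweighted on each product of two cells.
    Where the weight has a zero denominator the plan [l] vanishes as well. *)
Lemma cell_coupling (p : T -> 'I_n.+1) (l : 'I_n.+1 -> 'I_n.+1 -> R) :
  (forall i, measurable (p @^-1` [set i])) ->
  (forall i j, 0 <= l i j) ->
  (forall i, (\sum_j l i j)%:E = nu (p @^-1` [set i])) ->
  (forall j, (\sum_i l i j)%:E = mu (p @^-1` [set j])) ->
  exists theta : probability (T * T)%type R,
    [/\ forall A, measurable A -> theta (A `*` setT) = nu A,
        forall A, measurable A -> theta (setT `*` A) = mu A &
        forall i j, theta (p @^-1` [set i] `*` p @^-1` [set j]) = (l i j)%:E].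
Proof.
move=> mp l0 lnu lmu.
pose a i := \sum_j l i j; pose b j := \sum_i l i j.
have a0 i : 0 <= a i by exact: sumr_ge0.
have b0 i : 0 <= b i by exact: sumr_ge0.
have al i j : a i = 0 -> l i j = 0.
  by move=> ai0; exact: (psumr_eq0P (fun j _ => l0 i j) ai0).
have bl i j : b j = 0 -> l i j = 0.
  by move=> bj0; exact: (psumr_eq0P (fun i _ => l0 i j) bj0).
pose w i j := l i j / (a i * b j).
have w0 i j : 0 <= w i j by rewrite divr_ge0// mulr_ge0.
have wE i j : w i j * (a i * b j) = l i j.
  have [ai|ai] := eqVneq (a i) 0; first by rewrite ai mul0r mulr0 al.
  have [bj|bj] := eqVneq (b j) 0; first by rewrite bj !mulr0 bl.
  by rewrite /w divfK// mulf_neq0.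
pose cell i := p @^-1` [set i].
have mcell i j : measurable (cell i `*` cell j) by apply: measurableX; exact: mp.
pose m (i j : nat) := mscale (NngNum (w0 (inord i) (inord j)))
  (mrestr (nu \x mu)%E (mcell (inord i) (inord j))).
pose theta : {measure set (T * T)%type -> \bar R} :=
  msum (fun i => msum (m i) n.+1) n.+1.
have thetaE A B : measurable A -> measurable B -> theta (A `*` B) =
    (\sum_(i < n.+1) \sum_(j < n.+1)
      (w i j)%:E * (nu (A `&` cell i) * mu (B `&` cell j)))%E.
  move=> mA mB; rewrite /theta/= /msum; apply: eq_bigr => i _.
  apply: eq_bigr => j _; rewrite /= /mscale/= /mrestr/= !inord_val -setXI.
  by rewrite product_measure1E//; apply: measurableI => //; exact: mp.
have splitE (m' : probability T R) A : measurable A ->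
    (\sum_(i < n.+1) m' (A `&` cell i) = m' A)%E.
  move=> mA; rewrite -measure_bigsetU_ord.
  - congr (m' _); rewrite -(bigcup_pred (fun=> true)).
    by apply/seteqP; split=> [x [i _ []]//|x Ax]; exists (p x).
  - by move=> i; apply: measurableI => //; exact: mp.
  - by move=> i j _ _ [x [[_ /= <-] [_ /= <-]]].
have fin (m' : probability T R) A : measurable A -> m' A = (fine (m' A))%:E.
  by move=> mA; rewrite fineK// fin_num_measure.
have th1 A : measurable A -> theta (A `*` setT) = nu A.
  move=> mA; rewrite thetaE// -[RHS](splitE nu)//; apply: eq_bigr => i _.
  under eq_bigr => j _.
    rewrite setTI -[cell j]/(p @^-1` [set j]) -lmu fin; last first.
      by apply: measurableI => //; exact: mp.
    rewrite -!EFinM; over.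
  rewrite sumEFin fin; last by apply: measurableI => //; exact: mp.
  congr (_%:E); have [ai|ai] := eqVneq (a i) 0.
    have nu0 : nu (A `&` cell i) = 0%E.
      apply/eqP; rewrite eq_le measure_ge0 andbT.
      suff <- : nu (cell i) = 0%E.
        by rewrite le_measure// inE; [apply: measurableI => //|]; exact: mp.
      by rewrite -[cell i]/(p @^-1` [set i]) -lnu -/(a i) ai.
    by rewrite big1 nu0//= => j _; rewrite mul0r mulr0.
  transitivity (\sum_j fine (nu (A `&` cell i)) / a i * l i j); last first.
    by rewrite -mulr_sumr divfK.
  apply: eq_bigr => j _; rewrite -wE /b; field.
  by rewrite ai.
have th2 A : measurable A -> theta (setT `*` A) = mu A.
  move=> mA; rewrite thetaE// exchange_big -[RHS](splitE mu)//=.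
  apply: eq_bigr => j _.
  under eq_bigr => i _.
    rewrite setTI -[cell i]/(p @^-1` [set i]) -lnu fin; last first.
      by apply: measurableI => //; exact: mp.
    rewrite -!EFinM; over.
  rewrite sumEFin fin; last by apply: measurableI => //; exact: mp.
  congr (_%:E); have [bj|bj] := eqVneq (b j) 0.
    have mu0 : mu (A `&` cell j) = 0%E.
      apply/eqP; rewrite eq_le measure_ge0 andbT.
      suff <- : mu (cell j) = 0%E.
        by rewrite le_measure// inE; [apply: measurableI => //|]; exact: mp.
      by rewrite -[cell j]/(p @^-1` [set j]) -lmu -/(b j) bj.
    by rewrite big1 mu0//= => i _; rewrite !mulr0.
  transitivity (\sum_i fine (mu (A `&` cell j)) / b j * l i j); last first.
    by rewrite -mulr_sumr divfK.
  apply: eq_bigr => i _; rewrite -wE /a; field.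
  by rewrite bj.
have theta1 : theta setT = 1%E.
  by rewrite -setXTT th1// probability_setT.
pose thetaP := Measure_isProbability.Build _ _ _ theta theta1.
pose theta' := HB.pack_for (probability (T * T)%type R) (Measure.sort theta) thetaP.
exists theta'; split=> // i j.
rewrite [LHS]thetaE// ?(mp i) ?(mp j)//.
rewrite (bigD1 i)//= [X in (_ + X)%E]big1 ?adde0; last first.
  move=> i' i'i; apply: big1 => j' _.
  suff -> : p @^-1` [set i] `&` cell i' = set0 by rewrite measure0 mul0e mule0.
  apply/seteqP; split=> // x [/= pxi pxi'].
  by rewrite -pxi -pxi' eqxx in i'i.
rewrite (bigD1 j)//= [X in (_ + X)%E]big1 ?adde0; last first.
  move=> j' j'j.
  suff -> : p @^-1` [set j] `&` cell j' = set0 by rewrite measure0 !mule0.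
  apply/seteqP; split=> // x [/= pxj pxj'].
  by rewrite -pxj -pxj' eqxx in j'j.
by rewrite /cell !setIid -lnu -lmu -!EFinM wE.
Qed.

End CellCoupling.

(** * Expectations of bounded measurable functions *)

Section BoundedMeasurable.
Context disp (T : measurableType disp) (R : realType).
Implicit Types (f g : T -> R) (P : probability T R).

(** A class of functions stable under the algebra used below and integrable
    for every probability, so that linearity of the expectation holds on it
    without side conditions on the measure. *)
Definition bdd_measurable f :=
  measurable_fun setT f /\ exists M : R, forall x, `|f x| <= M.

Lemma bm_cst (c : R) : bdd_measurable (fun=> c).
Proof. by split; [exact: measurable_cst|exists `|c|]. Qed.

Lemma bmD f g : bdd_measurable f -> bdd_measurable g ->
  bdd_measurable (fun x => f x + g x).
Proof.
move=> [mf [M fM]] [mg [N gN]]; split; first exact: measurable_funD.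
by exists (M + N) => x; rewrite (le_trans (ler_normD _ _))// lerD.
Qed.

Lemma bmM f g : bdd_measurable f -> bdd_measurable g ->
  bdd_measurable (fun x => f x * g x).
Proof.
move=> [mf [M fM]] [mg [N gN]]; split; first exact: measurable_funM.
by exists (M * N) => x; rewrite normrM ler_pM.
Qed.

Lemma bmZ (k : R) f : bdd_measurable f -> bdd_measurable (fun x => k * f x).
Proof. by move=> bf; apply: bmM => //; exact: bm_cst. Qed.

Lemma bmN f : bdd_measurable f -> bdd_measurable (fun x => - f x).
Proof.
move=> bf; have -> : (fun x => - f x) = (fun x => -1 * f x).
  by apply/funext => x; rewrite mulN1r.
exact: bmZ.
Qed.

Lemma bmB f g : bdd_measurable f -> bdd_measurable g ->
  bdd_measurable (fun x => f x - g x).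
Proof. by move=> bf bg; apply: bmD => //; exact: bmN. Qed.

Lemma bm_sum (I : Type) (s : seq I) (p : pred I) (F : I -> T -> R) :
  (forall i, bdd_measurable (F i)) ->
  bdd_measurable (fun x => \sum_(i <- s | p i) F i x).
Proof.
move=> bF; elim: s => [|i s IH].
  by under eq_fun do rewrite big_nil; exact: bm_cst.
under eq_fun do rewrite big_cons; case: (p i) => //.
exact: bmD.
Qed.

Lemma bm_integrable P f : bdd_measurable f -> P.-integrable setT (EFin \o f).
Proof.
move=> [mf [M fM]]; apply: measurable_bounded_integrable => //.
  by apply: (le_lt_trans (probability_le1 P measurableT)); exact: ltry.
exists M; split; first exact: num_real.
by move=> x Mx y _ /=; rewrite (le_trans (fM y))// ltW.
Qed.

Lemma bm_RintegralE P f : bdd_measurable f ->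
  (\int[P]_x (f x)%:E)%E = (\int[P]_x f x)%:E.
Proof.
by move=> bf; rewrite /Rintegral fineK//; exact: integrable_fin_num (bm_integrable P bf).
Qed.

Lemma expect_cst P (c : R) : \int[P]_x c = c.
Proof. by rewrite Rintegral_cst// [X in fine X](@probability_setT _ _ _ P) mulr1. Qed.

Lemma expectD P f g : bdd_measurable f -> bdd_measurable g ->
  \int[P]_x (f x + g x) = \int[P]_x f x + \int[P]_x g x.
Proof. by move=> bf bg; rewrite RintegralD//; exact: bm_integrable. Qed.

Lemma expectB P f g : bdd_measurable f -> bdd_measurable g ->
  \int[P]_x (f x - g x) = \int[P]_x f x - \int[P]_x g x.
Proof. by move=> bf bg; rewrite RintegralB//; exact: bm_integrable. Qed.

Lemma expectZ P (k : R) f : bdd_measurable f ->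
  \int[P]_x (k * f x) = k * \int[P]_x f x.
Proof. by move=> bf; rewrite RintegralZl//; exact: bm_integrable. Qed.

Lemma expectN P f : bdd_measurable f -> \int[P]_x (- f x) = - \int[P]_x f x.
Proof.
by move=> bf; rewrite -mulN1r -expectZ//; apply: eq_Rintegral => x _; rewrite mulN1r.
Qed.

Lemma expect_sum P (I : Type) (s : seq I) (p : pred I) (F : I -> T -> R) :
  (forall i, bdd_measurable (F i)) ->
  \int[P]_x (\sum_(i <- s | p i) F i x) = \sum_(i <- s | p i) \int[P]_x F i x.
Proof.
move=> bF; elim: s => [|i s IH].
  by rewrite big_nil; under eq_Rintegral do rewrite big_nil; rewrite expect_cst.
rewrite big_cons -IH; under eq_Rintegral do rewrite big_cons.
by case: (p i) => //; rewrite expectD//; exact: bm_sum.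
Qed.

Lemma le_expect P f g : bdd_measurable f -> bdd_measurable g ->
  (forall x, f x <= g x) -> \int[P]_x f x <= \int[P]_x g x.
Proof. by move=> bf bg fg; apply: le_Rintegral => //; exact: bm_integrable. Qed.

Lemma expect_le_cst P f (c : R) : bdd_measurable f ->
  (forall x, f x <= c) -> \int[P]_x f x <= c.
Proof.
by move=> bf fc; rewrite -[leRHS](expect_cst P); apply: le_expect => //; exact: bm_cst.
Qed.

Lemma norm_expect_le P f g : bdd_measurable f -> bdd_measurable g ->
  (forall x, `|f x| <= g x) -> `|\int[P]_x f x| <= \int[P]_x g x.
Proof.
move=> bf bg fg; rewrite ler_norml -expectN//; apply/andP; split; apply: le_expect => //.
- exact: bmN.
- by move=> x; have := fg x; rewrite ler_norml => /andP[].
- by move=> x; have := fg x; rewrite ler_norml => /andP[].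
Qed.

Lemma norm_expect_le_cst P f (c : R) : bdd_measurable f ->
  (forall x, `|f x| <= c) -> `|\int[P]_x f x| <= c.
Proof.
move=> bf fc; rewrite -[leRHS](expect_cst P).
by apply: norm_expect_le => //; exact: bm_cst.
Qed.

End BoundedMeasurable.

Section Simple.
Context disp (T : measurableType disp) (R : realType).
Variables (n : nat) (p : T -> 'I_n.+1).
Hypothesis mp : forall i, measurable (p @^-1` [set i]).

Lemma comp_indexE (h : 'I_n.+1 -> R) x :
  h (p x) = \sum_i h i * \1_(p @^-1` [set i]) x.
Proof.
rewrite (bigD1 (p x))//= big1 ?addr0 => [|i ip].
  by rewrite indicE mem_set//= mulr1.
by rewrite indicE memNset ?mulr0//= => /esym/eqP; rewrite (negbTE ip).
Qed.

Lemma bm_indic (A : set T) : measurable A -> bdd_measurable (\1_A : T -> R).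
Proof.
move=> mA; split; first exact: measurable_indic.
by exists 1 => x; rewrite indicE; case: (_ \in _); rewrite ?normr1 ?normr0.
Qed.

Lemma bm_comp_index (h : 'I_n.+1 -> R) : bdd_measurable (h \o p).
Proof.
have -> : h \o p = (fun x => \sum_i h i * \1_(p @^-1` [set i]) x).
  by apply/funext => x; rewrite -comp_indexE.
by apply: bm_sum => i; apply: bmZ; exact: bm_indic.
Qed.

Lemma expect_indic (P : probability T R) (A : set T) : measurable A ->
  \int[P]_x (\1_A x : R) = fine (P A).
Proof. by move=> mA; rewrite /Rintegral integral_indic// setIT. Qed.

Lemma expect_comp_index (P : probability T R) (h : 'I_n.+1 -> R) :
  \int[P]_x h (p x) = \sum_i h i * fine (P (p @^-1` [set i])).
Proof.
under eq_Rintegral do rewrite comp_indexE.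
rewrite expect_sum; last by move=> i; apply: bmZ; exact: bm_indic.
by apply: eq_bigr => i _; rewrite expectZ ?expect_indic//; exact: bm_indic.
Qed.

End Simple.

(** * Kantorovich duality on the torus *)

Section TorusLipschitz.
Local Open Scope quotient_scope.
Variables (R : realType) (d : nat).
Local Notation T := (torus R d).
Implicit Types (x y z : T) (f : T -> R).

Definition lip (t : R) f := forall x y, f x - f y <= t * torus_dist x y.

Lemma lip_norm t f x y : lip t f -> `|f x - f y| <= t * torus_dist x y.
Proof.
move=> lf; rewrite ler_norml lf andbT lerNl opprB.
by rewrite torus_dist_sym; exact: lf.
Qed.

Lemma reduced_lift x : exists2 w : 'rV[R]_d, \pi_T w = x & forall j, `|w 0 j| <= 1 / 2.
Proof.
pose u := repr x.
exists (u - map_mx intr (\row_j Num.floor (u 0 j + 1 / 2))).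
  rewrite -[RHS]reprK; apply/esym/pi_torus_eq.
  by exists (\row_j Num.floor (u 0 j + 1 / 2)).
move=> j; rewrite !mxE ler_norml.
have := floor_le (u 0 j + 1 / 2); have := floorD1_gt (u 0 j + 1 / 2).
by rewrite intrD; set m := (Num.floor _)%:~R => *; apply/andP; split; lra.
Qed.

Lemma torus_dist_le_dim x y : torus_dist x y <= d%:R.
Proof.
have [w wE wj] := reduced_lift (x - y).
apply: (le_trans (torus_dist_le wE)); apply: (le_trans (enorm_le_norm _)).
rewrite -[leRHS]mulr1 ler_wpM2l// [leLHS]/Num.Def.normr/= mx_normrE.
apply/bigmax_leP; split=> // -[i j] _ /=; rewrite ord1.
by apply: (le_trans (wj j)); lra.
Qed.

Lemma lip_continuous t f : lip t f -> continuous f.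
Proof.
move=> lf x A /nbhs_ballP[e /= e0 eA].
have t0 : 0 < `|t| + 1 by rewrite ltr_wpDl.
apply/nbhs_ballP; exists (e / (`|t| + 1)); first by rewrite /= divr_gt0.
move=> y; rewrite ballEmdist/= mdist_torusE ltr_pdivlMr// mulrC => xy.
apply: eA; rewrite -ball_normE/=.
apply: (le_lt_trans (lip_norm _ _ lf)); apply: le_lt_trans xy.
rewrite ler_wpM2r ?torus_dist_ge0//.
by rewrite (le_trans (ler_norm t))// lerDl.
Qed.

Lemma torus_continuous_measurable f : continuous f -> measurable_fun setT f.
Proof.
move=> /continuousP cf; apply: (measurability _ (RGenOpens.measurableE R)).
move=> _ [_ [a [b ->] <-]]; rewrite setTI; apply: sub_sigma_algebra.
exact/cf/interval_open.
Qed.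

Lemma lip_bm t f : lip t f -> bdd_measurable f.
Proof.
move=> lf; split; first exact: torus_continuous_measurable (lip_continuous lf).
exists (`|f 0| + `|t| * d%:R) => x; rewrite -[f x](subrK (f 0)) addrC.
apply: (le_trans (ler_normD _ _)); rewrite lerD2l.
apply: (le_trans (lip_norm _ _ lf)).
apply: (@le_trans _ _ (`|t| * torus_dist x 0)).
  by rewrite ler_wpM2r ?torus_dist_ge0// ler_norm.
by rewrite ler_wpM2l// torus_dist_le_dim.
Qed.

Lemma lip_dist (c : T) : lip 1 (torus_dist c).
Proof.
by move=> x y; rewrite mul1r lerBlDl (torus_dist_sym x y); exact: torus_dist_triangle.
Qed.

Lemma open_torus_ball (c : T) (e : R) : open [set y | torus_dist c y < e].
Proof.
have /continuousP co := lip_continuous (lip_dist c).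
by apply: (co [set r | r < e]); exact: open_lt.
Qed.

(** Compactness gives finitely many centres; the cells are the fibres of
    the index of the first centre close to a point. *)
Lemma torus_cells (e : R) : 0 < e ->
  exists n, exists p : T -> 'I_n.+1, exists c : 'I_n.+1 -> T,
    (forall i, measurable (p @^-1` [set i])) /\
    forall y, torus_dist (c (p y)) y < e.
Proof.
move=> e0; have := @torus_compact R d; rewrite compact_cover.
move=> /(_ T setT (fun c => [set y | torus_dist c y < e])) [||D _ DT].
- by move=> c _; exact: open_torus_ball.
- by move=> y _; exists y; rewrite //= torus_distxx.
pose s : seq T := finmap.enum_fset D; pose q (y c : T) := torus_dist c y < e.
have hasq y : has (q y) s.
  have [c /= cD cy] := DT y Logic.I; apply/hasP; exists c => //.
have mfind (s' : seq T) k : measurable [set y | find (q y) s' = k].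
  elim: s' k => [|c s' IH] k /=.
    have [<-|k0] := eqVneq 0%N k; first by rewrite (_ : [set y | _] = setT)// -subTset.
    by rewrite (_ : [set y | _] = set0)// -subset0 => y /= /eqP; rewrite (negbTE k0).
  have mc : measurable [set y | torus_dist c y < e].
    by apply: sub_sigma_algebra; exact: open_torus_ball.
  case: k => [|k].
    rewrite (_ : [set y | _] = [set y | torus_dist c y < e])//.
    by apply/seteqP; split=> y /=; rewrite /q; case: ifP.
  rewrite (_ : [set y | _] =
      ~` [set y | torus_dist c y < e] `&` [set y | find (q y) s' = k]).
    by apply: measurableI => //; exact: measurableC.
  apply/seteqP; split=> y /=; rewrite /q; case: ifP => // _.
  - by move=> [->].
  - by case.
  - by move=> [_ ->].
exists (size s), (fun y => inord (find (q y) s)), (fun i => nth 0 s i).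
split=> [i|y]; last first.
  rewrite inordK; last by rewrite ltnS find_size.
  exact: (nth_find 0 (hasq y)).
have -> : (fun y => inord (find (q y) s)) @^-1` [set i] = [set y | find (q y) s = i].
  apply/seteqP; split=> y /=; last by move=> ->; rewrite inord_val.
  by move=> <-; rewrite inordK// ltnS find_size.
exact: mfind.
Qed.

Lemma bm_torus_dist : bdd_measurable (fun z : T * T => torus_dist z.1 z.2).
Proof.
split; last by exists d%:R => z; rewrite ger0_norm ?torus_dist_ge0// torus_dist_le_dim.
have /continuousP cd : continuous (fun z : T * T => torus_dist z.1 z.2).
  move=> -[x y] A /nbhs_ballP[e /= e0 eA].
  apply/nbhs_ballP; exists (e / 2); first by rewrite /= divr_gt0.
  move=> [a b] [/=]; rewrite !ballEmdist/= !mdist_torusE => xa yb.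
  apply: eA; rewrite -ball_normE/= ltr_norml.
  have := torus_dist_triangle a x b; have := torus_dist_triangle x a y.
  have := torus_dist_triangle y a b; have := torus_dist_triangle b x y.
  rewrite (torus_dist_sym a x) (torus_dist_sym b y).
  move: (torus_dist x a) (torus_dist y b) (torus_dist x b) (torus_dist x y)
    (torus_dist a b) (torus_dist a y) xa yb => xa yb xb xy ab ay *.
  by apply/andP; split; lra.
apply: (measurability _ (RGenOpens.measurableE R)).
move=> _ [_ [a [b ->] <-]]; rewrite setTI; apply: open_measurable_torusX.
exact/cd/interval_open.
Qed.

(** McShane's extension of a Lipschitz function from a finite set. *)
Lemma inf_convolution_lip n (D : 'I_n.+1 -> T) (h : 'I_n.+1 -> R) t : 0 <= t ->
  (forall i j, h i - h j <= t * torus_dist (D i) (D j)) ->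
  exists2 f, lip t f & forall i, f (D i) = h i.
Proof.
move=> t0 hl.
have /choice[p pP] y := finite_argmin (fun i => h i + t * torus_dist y (D i)).
exists (fun y => h (p y) + t * torus_dist y (D (p y))) => [x y|i].
  have := pP x (p y); have := ler_wpM2l t0 (torus_dist_triangle y x (D (p y))).
  rewrite mulrDr; move: (torus_dist x _) (torus_dist x y) (torus_dist y _).
  by move=> xp xy yp; lra.
have := pP (D i) i; have := hl i (p (D i)); rewrite torus_distxx; lra.
Qed.

(** The substantial half of Kantorovich duality. Both measures are
    discretized on small cells, the discrete problem is solved by linear
    programming duality, and the resulting plan is spread over the cells. Each
    replacement of a point by the centre of its cell costs at most the size of
    the cell, in the test functions as in the transport cost. *)
Lemma kantorovich_le (nu mu : probability T R) (c : R) :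
  (forall t f, 0 <= t -> lip t f -> \int[nu]_x f x - \int[mu]_x f x <= c * t) ->
  (wasserstein1 nu mu <= c%:E)%E.
Proof.
move=> H; apply/lee_addgt0Pr => e e0.
have e40 : 0 < e / 4 by rewrite divr_gt0.
have [n [p [C [mp pC]]]] := torus_cells e40.
pose a i := fine (nu (p @^-1` [set i])); pose b i := fine (mu (p @^-1` [set i])).
have aE i : (a i)%:E = nu (p @^-1` [set i]) by rewrite /a fineK// fin_num_measure.
have bE i : (b i)%:E = mu (p @^-1` [set i]) by rewrite /b fineK// fin_num_measure.
have [|||||l [l0 la lb lc]] := @finite_transport R n
    (fun i j => torus_dist (C i) (C j)) a b (c + e / 2).
- by move=> i; rewrite torus_distxx.
- by move=> i j k; exact: torus_dist_triangle.
- by move=> i; rewrite fine_ge0.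
- by move=> i; rewrite fine_ge0.
- move=> t h t0 hl; have [f lf fC] := inf_convolution_lip t0 hl.
  have bh := bm_comp_index mp h; have bf := lip_bm lf.
  have close (m : probability T R) : `|\int[m]_x (f x - h (p x))| <= t * (e / 4).
    apply: norm_expect_le_cst => [|x]; first exact: bmB.
    rewrite -fC; apply: (le_trans (lip_norm _ _ lf)).
    by rewrite ler_wpM2l// torus_dist_sym ltW.
  have := close nu; have := close mu; rewrite !expectB//.
  have := H t f t0 lf; rewrite -!(expect_comp_index mp).
  by rewrite !ler_norml => ? /andP[? ?] /andP[? ?]; lra.
have [||theta [th1 th2 th3]] := @cell_coupling _ T R nu mu n p l mp l0.
- by move=> i; rewrite la aE.
- by move=> j; rewrite lb bE.
apply: (@le_trans _ _ (\int[theta]_z (mdist z.1 z.2)%:E)%E).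
  apply: ereal_inf_lbound; exists theta => //; split=> A mA.
    by rewrite /pushforward -setXT th1.
  by rewrite /pushforward -setTX th2.
rewrite -[leLHS]/(\int[theta]_z (torus_dist z.1 z.2)%:E)%E.
rewrite bm_RintegralE; last exact: bm_torus_dist.
rewrite -EFinD lee_fin.
pose cell i j := p @^-1` [set i] `*` p @^-1` [set j].
have mcell i j : measurable (cell i j) by apply: measurableX; exact: mp.
pose K i j := torus_dist (C i) (C j) + e / 2.
have bcell i j : bdd_measurable (fun z : T * T => K i j * (\1_(cell i j) z : R)).
  by apply: bmZ; exact: bm_indic.
have dK (z : T * T) : torus_dist z.1 z.2 <= \sum_i \sum_j K i j * \1_(cell i j) z.
  have K0 i j : 0 <= K i j by rewrite addr_ge0 ?torus_dist_ge0// divr_ge0// ltW.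
  rewrite (bigD1 (p z.1))//= (bigD1 (p z.2))//= indicE mem_set//= mulr1.
  rewrite -addrA; apply: (@le_trans _ _ (K (p z.1) (p z.2))).
    have := torus_dist_triangle (C (p z.1)) z.1 z.2.
    have := torus_dist_triangle (C (p z.2)) (C (p z.1)) z.2.
    have := pC z.1; have := pC z.2.
    rewrite (torus_dist_sym z.1 (C _)) /K.
    move: (torus_dist _ z.1) (torus_dist _ z.2) (torus_dist _ z.2) (torus_dist z.1 _).
    by move: (torus_dist _ _) => u v w s t *; lra.
  rewrite lerDl addr_ge0// ?sumr_ge0// => i _; last apply: sumr_ge0 => j _.
    by rewrite mulr_ge0.
  by rewrite mulr_ge0.
apply: (le_trans (le_expect theta bm_torus_dist _ dK)).
  by do 2 apply: bm_sum => ?.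
rewrite expect_sum; last by move=> i; exact: bm_sum.
under eq_bigr => i _.
  rewrite expect_sum//; under eq_bigr => j _.
    rewrite expectZ; last exact: bm_indic.
    rewrite expect_indic// [theta _]th3/= mulrDl mulrC; over.
  rewrite big_split/=; over.
rewrite big_split/=.
suff -> : \sum_i \sum_j e / 2 * l i j = e / 2 by lra.
under eq_bigr => i _ do rewrite -mulr_sumr la.
have /= := expect_comp_index mp nu (fun=> 1); rewrite expect_cst.
under eq_bigr => i _ do rewrite mul1r.
by rewrite -mulr_sumr /a => <-; rewrite mulr1.
Qed.

End TorusLipschitz.

(** * Characters and the Haar measure *)

Section Dotp.
Variables (R : realType) (d : nat).
Implicit Types (h : 'rV[int]_d) (u v : 'rV[R]_d).

Lemma dotpDr h u v : dotp h (u + v) = dotp h u + dotp h v.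
Proof. by rewrite /dotp -big_split/=; apply: eq_bigr => j _; rewrite mxE mulrDr. Qed.

Lemma dotpNr h u : dotp h (- u) = - dotp h u.
Proof. by rewrite /dotp -sumrN; apply: eq_bigr => j _; rewrite mxE mulrN. Qed.

Lemma dotpDl h h' u : dotp (h + h') u = dotp h u + dotp h' u.
Proof.
by rewrite /dotp -big_split/=; apply: eq_bigr => j _; rewrite mxE intrD mulrDl.
Qed.

Lemma dotpNl h u : dotp (- h) u = - dotp h u.
Proof. by rewrite /dotp -sumrN; apply: eq_bigr => j _; rewrite mxE mulrNz mulNr. Qed.

Lemma dotpZl (m : int) h u : dotp (m *: h) u = m%:~R * dotp h u.
Proof.
by rewrite /dotp mulr_sumr; apply: eq_bigr => j _; rewrite mxE intrM mulrA.
Qed.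

Lemma dotpMz h u (n : int) : dotp h (u *~ n) = n%:~R * dotp h u.
Proof.
rewrite /dotp mulr_sumr; apply: eq_bigr => j _.
by rewrite -[u *~ n]scaler_int mxE mulrCA.
Qed.

Lemma dotp_int h (m : 'rV[int]_d) : exists n : int, dotp h (map_mx intr m) = n%:~R :> R.
Proof.
exists (\sum_j h 0 j * m 0 j); rewrite /dotp rmorph_sum/=; apply: eq_bigr => j _.
by rewrite mxE rmorphM.
Qed.

Lemma dotp_delta h j (t : R) : dotp h (t *: delta_mx 0 j) = (h 0 j)%:~R * t.
Proof.
rewrite /dotp (bigD1 j)//= big1 => [|i ij]; rewrite !mxE eqxx ?eqxx/= ?mulr1 ?addr0//.
by rewrite (negbTE ij) !mulr0.
Qed.

Lemma delta_dotp j u : dotp (delta_mx 0 j) u = u 0 j.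
Proof.
rewrite /dotp (bigD1 j)//= big1 => [|i ij]; rewrite !mxE eqxx ?eqxx/= ?mul1r ?addr0//.
by rewrite (negbTE ij) mul0r.
Qed.

Lemma norm_dotp_le h u : `|dotp h u| <= (\sum_j `|(h 0 j)%:~R|) * enorm u.
Proof.
rewrite /dotp mulr_suml; apply: (le_trans (ler_norm_sum _ _ _)).
by apply: ler_sum => j _; rewrite normrM ler_wpM2l// ler_coord_enorm.
Qed.

End Dotp.

Section Turn.
Variable R : realType.
Implicit Types (t s : R) (n : int).

Definition turn t : R := t * (pi *+ 2).

Lemma turnD t s : turn (t + s) = turn t + turn s. Proof. exact: mulrDl. Qed.
Lemma turnN t : turn (- t) = - turn t. Proof. exact: mulNr. Qed.

Lemma cos_turnDz t n : cos (turn (t + n%:~R)) = cos (turn t).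
Proof.
rewrite turnD {2}/turn; case: n => n; rewrite ?NegzE ?mulrNz.
  by rewrite -pmulrn mulr_natl (periodicn (@cosD2pi R)).
rewrite mulNr -[in RHS](subrK (n.+1%:~R * (pi *+ 2)) (turn t)).
by rewrite -pmulrn mulr_natl (periodicn (@cosD2pi R)).
Qed.

Lemma sin_turnDz t n : sin (turn (t + n%:~R)) = sin (turn t).
Proof.
rewrite turnD {2}/turn; case: n => n; rewrite ?NegzE ?mulrNz.
  by rewrite -pmulrn mulr_natl (periodicn (@sinD2pi R)).
rewrite mulNr -[in RHS](subrK (n.+1%:~R * (pi *+ 2)) (turn t)).
by rewrite -pmulrn mulr_natl (periodicn (@sinD2pi R)).
Qed.

Lemma turn_half : turn (1 / 2) = pi.
Proof. by rewrite /turn -mulr_natr; lra. Qed.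

End Turn.

Section Characters.
Local Open Scope quotient_scope.
Variables (R : realType) (d : nat).
Local Notation T := (torus R d).
Implicit Types (x y z : T) (h : 'rV[int]_d) (u v : 'rV[R]_d).

Definition cosT h x : R := cos (turn (dotp h (repr x))).
Definition sinT h x : R := sin (turn (dotp h (repr x))).

Lemma dotp_repr h u : exists n : int, dotp h (repr (\pi_T u)) = dotp h u + n%:~R.
Proof.
have /pi_torus_eq[m ->] : \pi_T u = \pi_T (repr (\pi_T u)) by rewrite reprK.
have [n nE] := dotp_int R h m.
by exists (- n); rewrite dotpDr dotpNr nE mulrNz.
Qed.

Lemma cosT_pi h u : cosT h (\pi_T u) = cos (turn (dotp h u)).
Proof. by rewrite /cosT; have [n ->] := dotp_repr h u; rewrite cos_turnDz. Qed.

Lemma sinT_pi h u : sinT h (\pi_T u) = sin (turn (dotp h u)).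
Proof. by rewrite /sinT; have [n ->] := dotp_repr h u; rewrite sin_turnDz. Qed.

Lemma cosTD h x y : cosT h (x + y) = cosT h x * cosT h y - sinT h x * sinT h y.
Proof. by rewrite -[x]reprK -[y]reprK -pi_torusD !cosT_pi !sinT_pi dotpDr turnD cosD. Qed.

Lemma sinTD h x y : sinT h (x + y) = sinT h x * cosT h y + cosT h x * sinT h y.
Proof. by rewrite -[x]reprK -[y]reprK -pi_torusD !cosT_pi !sinT_pi dotpDr turnD sinD. Qed.

Lemma cosTN h x : cosT h (- x) = cosT h x.
Proof. by rewrite -[x]reprK -pi_torusN !cosT_pi dotpNr turnN cosN. Qed.

Lemma sinTN h x : sinT h (- x) = - sinT h x.
Proof. by rewrite -[x]reprK -pi_torusN !sinT_pi dotpNr turnN sinN. Qed.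

Lemma cosTB h x y : cosT h (x - y) = cosT h x * cosT h y + sinT h x * sinT h y.
Proof. by rewrite cosTD cosTN sinTN mulrN opprK. Qed.

Lemma cosT0l x : cosT 0 x = 1.
Proof. by rewrite /cosT /dotp big1 => [|j _]; rewrite ?mxE ?mul0r// /turn mul0r cos0. Qed.

Lemma sinT0l x : sinT 0 x = 0.
Proof. by rewrite /sinT /dotp big1 => [|j _]; rewrite ?mxE ?mul0r// /turn mul0r sin0. Qed.

Lemma cosT0 h : cosT h 0 = 1.
Proof.
by rewrite -pi_torus0 cosT_pi /dotp big1 => [|j _]; rewrite ?mxE ?mulr0// /turn mul0r cos0.
Qed.

Lemma sinT0 h : sinT h 0 = 0.
Proof.
by rewrite -pi_torus0 sinT_pi /dotp big1 => [|j _]; rewrite ?mxE ?mulr0// /turn mul0r sin0.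
Qed.

Lemma cosTNl h x : cosT (- h) x = cosT h x.
Proof. by rewrite /cosT dotpNl turnN cosN. Qed.

Lemma sinTNl h x : sinT (- h) x = - sinT h x.
Proof. by rewrite /sinT dotpNl turnN sinN. Qed.

Lemma cosTM h h' x : cosT h x * cosT h' x = (cosT (h + h') x + cosT (h - h') x) / 2.
Proof. by rewrite /cosT !dotpDl dotpNl !turnD turnN cosD cosB; lra. Qed.

Lemma sinTM h h' x : sinT h x * sinT h' x = (cosT (h - h') x - cosT (h + h') x) / 2.
Proof. by rewrite /cosT /sinT !dotpDl dotpNl !turnD turnN cosB cosD; lra. Qed.

Lemma sincosTM h h' x : sinT h x * cosT h' x = (sinT (h + h') x + sinT (h - h') x) / 2.
Proof. by rewrite /cosT /sinT !dotpDl dotpNl !turnD turnN sinD sinB; lra. Qed.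

(** The section [repr] is not continuous, but near [x] the phase at [y]
    agrees modulo 1 with an affine function of a short lift of [x - y]. *)
Lemma phase_continuous (g : R -> R) h : continuous g ->
  (forall t (n : int), g (turn (t + n%:~R)) = g (turn t)) ->
  continuous (fun x : T => g (turn (dotp h (repr x)))).
Proof.
move=> cg gz x A; rewrite /= => Ax.
pose M := (\sum_j `|(h 0 j)%:~R|) * (pi *+ 2) + 1 : R.
have M0 : 0 < M.
  by rewrite ltr_wpDl// mulr_ge0 ?sumr_ge0// mulrn_wge0// pi_ge0.
have /nbhs_ballP[e /= e0 eA] := cg _ _ Ax.
apply/nbhs_ballP; exists (e / M); first by rewrite /= divr_gt0.
move=> y; rewrite ballEmdist/= mdist_torusE => xy.
have xy0 : 0 < e / M - torus_dist x y by rewrite subr_gt0.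
have [w wE we] := torus_dist_adherent x y xy0.
have -> : y = \pi_T (repr x - w) by rewrite pi_torusB reprK wE opprB addrC subrK.
have [n ->] := dotp_repr h (repr x - w); rewrite gz.
apply: eA; rewrite -ball_normE/= dotpDr dotpNr turnD turnN opprD addrA subrr sub0r opprK.
have wM : enorm w * M < e by rewrite -ltr_pdivlMr//; lra.
apply: le_lt_trans wM; rewrite /turn normrM (ger0_norm (mulrn_wge0 _ (pi_ge0 _))).
apply: (@le_trans _ _ ((\sum_j `|(h 0 j)%:~R|) * enorm w * (pi *+ 2))).
  by rewrite ler_wpM2r ?norm_dotp_le// mulrn_wge0// pi_ge0.
by rewrite mulrAC mulrC ler_wpM2l ?enorm_ge0// lerDl.
Qed.

Lemma bm_cosT h : bdd_measurable (cosT h).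
Proof.
split; last by exists 1 => x; exact: cos_max.
apply: torus_continuous_measurable; apply: phase_continuous; first exact: continuous_cos.
exact: cos_turnDz.
Qed.

Lemma bm_sinT h : bdd_measurable (sinT h).
Proof.
split; last by exists 1 => x; exact: sin_max.
apply: torus_continuous_measurable; apply: phase_continuous; first exact: continuous_sin.
exact: sin_turnDz.
Qed.

End Characters.
Arguments bm_cosT {R d} h.
Arguments bm_sinT {R d} h.

Section Haar.
Local Open Scope quotient_scope.
Variables (R : realType) (d : nat).
Local Notation T := (torus R d).
Variable mu : probability T R.
Hypothesis mu_haar : is_haar mu.
Implicit Types (h : 'rV[int]_d).

Lemma haar_shift (f : T -> R) (a : T) :
  bdd_measurable f -> bdd_measurable (fun x : T => f (x + a)) ->
  \int[mu]_x f ((x : T) + a) = \int[mu]_x f x.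
Proof.
move=> bf bfa.
pose phi (x : T) : T := x + a.
have mphi : measurable_fun setT phi.
  exact: (measurable_fun_pair1 a (@measurable_torus_add R d)).
congr fine; rewrite -[LHS]/(\int[mu]_(x in phi @^-1` setT) ((EFin \o f) \o phi) x)%E.
rewrite -integral_pushforward//; last 2 first.
- by apply/measurable_EFinP; exact: bf.1.
- exact: bm_integrable bfa.
apply: eq_measure_integral => A mA _.
rewrite -[RHS](mu_haar (- a))//; congr (mu _).
apply/seteqP; split=> x /=; first by exists (phi x) => //; rewrite /phi addrC addrK.
by move=> [y Ay <-]; rewrite /phi addrC addNKr.
Qed.

(** Translating by half a period flips the sign of the characters, which
    is what makes their Haar integrals vanish. *)
Lemma half_period h : h != 0 -> exists a : T, forall x,
  cosT h (x + a) = - cosT h x /\ sinT h (x + a) = - sinT h x.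
Proof.
move=> h0; have [j hj] : exists j, h 0 j != 0.
  apply/existsP; apply: contraNT h0; rewrite negb_exists => /forallP h0.
  by apply/eqP/rowP => j; rewrite mxE; apply/eqP; rewrite -[_ == _]negbK.
pose t : R := 1 / 2 / (h 0 j)%:~R.
exists (\pi_T (t *: delta_mx 0 j)) => x; rewrite cosTD sinTD cosT_pi sinT_pi dotp_delta.
have -> : (h 0 j)%:~R * t = 1 / 2 by rewrite /t mulrC divfK// intr_eq0.
rewrite turn_half cospi sinpi.
by split; ring.
Qed.

Lemma expect_cosT h : \int[mu]_x cosT h x = (h == 0)%:R.
Proof.
have [->|h0] := eqVneq h 0.
  by rewrite -[RHS](expect_cst mu); apply: eq_Rintegral => x _; rewrite cosT0l.
have [a aE] := half_period h0.
have := haar_shift (a := a) (f := cosT h) (bm_cosT h).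
have -> : (fun x : T => cosT h (x + a)) = (fun x => - cosT h x).
  by apply/funext => x; case: (aE x).
move=> /(_ (bmN (bm_cosT h))); rewrite expectN; last exact: bm_cosT.
by rewrite /=; lra.
Qed.

Lemma expect_sinT h : \int[mu]_x sinT h x = 0.
Proof.
have [->|h0] := eqVneq h 0.
  by rewrite -[RHS](expect_cst mu); apply: eq_Rintegral => x _; rewrite sinT0l.
have [a aE] := half_period h0.
have := haar_shift (a := a) (f := sinT h) (bm_sinT h).
have -> : (fun x : T => sinT h (x + a)) = (fun x => - sinT h x).
  by apply/funext => x; case: (aE x).
move=> /(_ (bmN (bm_sinT h))); rewrite expectN; last exact: bm_sinT.
by rewrite /=; lra.
Qed.

Lemma expect_cosT_cosT h h' :
  \int[mu]_x (cosT h x * cosT h' x) = ((h == h')%:R + (h == - h')%:R) / 2.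
Proof.
under eq_Rintegral do rewrite cosTM mulrC.
rewrite expectZ ?expectD ?expect_cosT; [|exact: bm_cosT..|by apply: bmD; exact: bm_cosT].
by rewrite subr_eq0 addr_eq0; lra.
Qed.

Lemma expect_sinT_sinT h h' :
  \int[mu]_x (sinT h x * sinT h' x) = ((h == h')%:R - (h == - h')%:R) / 2.
Proof.
under eq_Rintegral do rewrite sinTM mulrC.
rewrite expectZ ?expectB ?expect_cosT; [|exact: bm_cosT..|by apply: bmB; exact: bm_cosT].
by rewrite subr_eq0 addr_eq0; lra.
Qed.

Lemma expect_sinT_cosT h h' : \int[mu]_x (sinT h x * cosT h' x) = 0.
Proof.
under eq_Rintegral do rewrite sincosTM mulrC.
rewrite expectZ ?expectD ?expect_sinT; [|exact: bm_sinT..|by apply: bmD; exact: bm_sinT].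
by rewrite addr0 mulr0.
Qed.

End Haar.

(** * Trigonometric polynomials and Parseval *)

(** The quadratic form k^2 U - 2 k l S + l^2 V is a sum of squares; it is
    evaluated at (V, S), or at (S, U + 1) when V = 0. *)
Lemma sum_cauchy_schwarz (R : realFieldType) (I : Type) (s : seq I) (p : pred I)
    (a b x y : I -> R) :
  (\sum_(i <- s | p i) (a i * x i + b i * y i)) ^+ 2 <=
  (\sum_(i <- s | p i) (a i ^+ 2 + b i ^+ 2)) *
  (\sum_(i <- s | p i) (x i ^+ 2 + y i ^+ 2)).
Proof.
set S := \sum_(i <- s | p i) (a i * x i + b i * y i).
set U := \sum_(i <- s | p i) (a i ^+ 2 + b i ^+ 2).
set V := \sum_(i <- s | p i) (x i ^+ 2 + y i ^+ 2).
have Q (k l : R) : 0 <= k ^+ 2 * U - 2 * k * l * S + l ^+ 2 * V.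
  have -> : k ^+ 2 * U - 2 * k * l * S + l ^+ 2 * V =
      \sum_(i <- s | p i) ((k * a i - l * x i) ^+ 2 + (k * b i - l * y i) ^+ 2).
    rewrite /U /S /V !mulr_sumr -sumrN -!big_split/=; apply: eq_bigr => i _; ring.
  by apply: sumr_ge0 => i _; rewrite addr_ge0// sqr_ge0.
have V0 : 0 <= V by apply: sumr_ge0 => i _; rewrite addr_ge0// sqr_ge0.
have U0 : 0 <= U by apply: sumr_ge0 => i _; rewrite addr_ge0// sqr_ge0.
have [VE|Vn0] := eqVneq V 0.
  have := Q S (U + 1); rewrite VE !mulr0 addr0 => H.
  suff : S ^+ 2 <= 0 by [].
  rewrite leNgt; apply/negP => S0.
  have : S ^+ 2 * (U + 2) <= 0.
    by rewrite -oppr_ge0; apply: (le_trans H); apply: eq_ler; ring.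
  by rewrite leNgt mulr_gt0// ltr_wpDl.
have := Q V S.
have -> : V ^+ 2 * U - 2 * V * S * S + S ^+ 2 * V = V * (U * V - S ^+ 2) by ring.
by rewrite pmulr_rge0 ?subr_ge0// lt_def Vn0.
Qed.

Section Box.
Variable d : nat.
Implicit Types (m n : nat) (h : 'rV[int]_d).

Definition box (n : nat) : seq 'rV[int]_d :=
  [seq \row_j ((u j : nat)%:Z - n%:Z) | u : {ffun 'I_d -> 'I_(n + n).+1}].

Lemma mem_box n h : (h \in box n) = [forall j, `|h 0 j| <= n%:Z].
Proof.
apply/mapP/forallP => [[u _ -> j]|hn].
  have := ltn_ord (u j); rewrite mxE ltnS ler_norml. move: (nat_of_ord _) => k kn.
  by apply/andP; split; lia.
exists [ffun j => inord (absz (h 0 j + n%:Z)%R)]; first by rewrite mem_enum.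
apply/rowP => j; rewrite mxE ffunE.
have := hn j; rewrite ler_norml => /andP[h1 h2] {hn}.
by move: (h 0 j) h1 h2 => z h1 h2; rewrite inordK; lia.
Qed.

Lemma box_uniq n : uniq (box n).
Proof.
rewrite map_inj_uniq ?enum_uniq// => u v /rowP uv; apply/ffunP => j.
by have := uv j; rewrite !mxE => /addIr[] /val_inj.
Qed.

Lemma box_opp n h : (- h \in box n) = (h \in box n).
Proof. by rewrite !mem_box; apply: eq_forallb => j; rewrite mxE normrN. Qed.

Lemma box0 n : 0 \in box n.
Proof. by rewrite mem_box; apply/forallP => j; rewrite mxE normr0. Qed.

Lemma sum_box_delta (R : pzRingType) n h (F : 'rV[int]_d -> R) : h \in box n ->
  \sum_(k <- box n) (k == h)%:R * F k = F h.
Proof.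
move=> hn; rewrite (bigD1_seq h)//= ?box_uniq// eqxx mul1r big1 ?addr0//.
by move=> m /negbTE ->; rewrite mul0r.
Qed.

Lemma box_le m n h : (m <= n)%N -> h \in box m -> h \in box n.
Proof.
move=> mn; rewrite !mem_box => /forallP hm; apply/forallP => j.
by apply: (le_trans (hm j)); rewrite lez_nat.
Qed.

End Box.

Section TrigPoly.
Variables (R : realType) (d : nat).
Local Notation T := (torus R d).
Variable mu : probability T R.
Hypothesis mu_haar : is_haar mu.
Implicit Types (h m : 'rV[int]_d) (f g : T -> R).

Definition cos_coef f h := \int[mu]_x (f x * cosT h x).
Definition sin_coef f h := \int[mu]_x (f x * sinT h x).

(** Summing over both h and - h makes the coefficients plain integrals,
    without the usual factor 2. *)
Definition trigpoly n g := bdd_measurable g /\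
  forall x, g x = \sum_(h <- box d n) (cos_coef g h * cosT h x + sin_coef g h * sinT h x).

Lemma trigpoly_cosT n m : m \in box d n -> trigpoly n (cosT m).
Proof.
move=> mn; split; first exact: bm_cosT.
move=> x; rewrite /cos_coef /sin_coef.
transitivity (\sum_(h <- box d n)
    ((h == m)%:R * (cosT h x / 2) + (h == - m)%:R * (cosT h x / 2))); last first.
  apply: eq_bigr => h _; rewrite expect_cosT_cosT//.
  under [X in _ = _ + X * _]eq_Rintegral do rewrite mulrC.
  by rewrite expect_sinT_cosT// mul0r addr0 (eq_sym m h) (eq_sym m (- h)) eqr_oppLR; lra.
rewrite big_split/= !sum_box_delta ?box_opp// cosTNl; lra.
Qed.

Lemma trigpoly_sinT n m : m \in box d n -> trigpoly n (sinT m).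
Proof.
move=> mn; split; first exact: bm_sinT.
move=> x; rewrite /cos_coef /sin_coef.
transitivity (\sum_(h <- box d n)
    ((h == m)%:R * (sinT h x / 2) - (h == - m)%:R * (sinT h x / 2))); last first.
  apply: eq_bigr => h _; rewrite expect_sinT_sinT// expect_sinT_cosT//.
  by rewrite mul0r add0r (eq_sym m h) (eq_sym m (- h)) eqr_oppLR; lra.
rewrite sumrB/= !sum_box_delta ?box_opp// sinTNl; lra.
Qed.

Lemma cos_coefD f g h : bdd_measurable f -> bdd_measurable g ->
  cos_coef (fun x => f x + g x) h = cos_coef f h + cos_coef g h.
Proof.
move=> bf bg; rewrite /cos_coef -expectD; [|by apply: bmM => //; exact: bm_cosT..].
by apply: eq_Rintegral => x _; rewrite mulrDl.
Qed.

Lemma sin_coefD f g h : bdd_measurable f -> bdd_measurable g ->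
  sin_coef (fun x => f x + g x) h = sin_coef f h + sin_coef g h.
Proof.
move=> bf bg; rewrite /sin_coef -expectD; [|by apply: bmM => //; exact: bm_sinT..].
by apply: eq_Rintegral => x _; rewrite mulrDl.
Qed.

Lemma cos_coefZ k f h : bdd_measurable f -> cos_coef (fun x => k * f x) h = k * cos_coef f h.
Proof.
move=> bf; rewrite /cos_coef -expectZ; last by apply: bmM => //; exact: bm_cosT.
by apply: eq_Rintegral => x _; rewrite mulrA.
Qed.

Lemma sin_coefZ k f h : bdd_measurable f -> sin_coef (fun x => k * f x) h = k * sin_coef f h.
Proof.
move=> bf; rewrite /sin_coef -expectZ; last by apply: bmM => //; exact: bm_sinT.
by apply: eq_Rintegral => x _; rewrite mulrA.
Qed.

Lemma trigpolyD n f g : trigpoly n f -> trigpoly n g ->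
  trigpoly n (fun x => f x + g x).
Proof.
move=> [bf fE] [bg gE]; split; first exact: bmD.
move=> x; rewrite fE gE -big_split/=; apply: eq_bigr => h _.
rewrite cos_coefD// sin_coefD//; ring.
Qed.

Lemma trigpolyZ n k f : trigpoly n f -> trigpoly n (fun x => k * f x).
Proof.
move=> [bf fE]; split; first exact: bmZ.
move=> x; rewrite fE mulr_sumr; apply: eq_bigr => h _.
rewrite cos_coefZ// sin_coefZ//; ring.
Qed.

Lemma trigpoly_sum n (I : Type) (s : seq I) (F : I -> T -> R) :
  (forall i, trigpoly n (F i)) -> trigpoly n (fun x => \sum_(i <- s) F i x).
Proof.
move=> tF; elim: s => [|i s IH].
  have -> : (fun x : T => \sum_(i <- [::]) F i x) = (fun x => 0 * cosT 0 x).
    by apply/funext => x; rewrite big_nil mul0r.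
  by apply: trigpolyZ; apply: trigpoly_cosT; exact: box0.
under eq_fun do rewrite big_cons; exact: trigpolyD.
Qed.

Definition fourier_sq (nu : probability T R) h :=
  (\int[nu]_x cosT h x) ^+ 2 + (\int[nu]_x sinT h x) ^+ 2.

Lemma trigpoly_integral (nu : probability T R) n g : trigpoly n g ->
  \int[nu]_x g x = \sum_(h <- box d n)
    (cos_coef g h * \int[nu]_x cosT h x + sin_coef g h * \int[nu]_x sinT h x).
Proof.
move=> [bg gE]; rewrite (eq_Rintegral _ (fun x _ => gE x)) expect_sum; last first.
  by move=> h; apply: bmD; apply: bmZ; [exact: bm_cosT|exact: bm_sinT].
apply: eq_bigr => h _; rewrite expectD ?expectZ//.
- exact: bm_sinT.
- exact: bm_cosT.
- by apply: bmZ; exact: bm_cosT.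
- by apply: bmZ; exact: bm_sinT.
Qed.

Lemma trigpoly_parseval n g : trigpoly n g ->
  \int[mu]_x (g x * g x) = \sum_(h <- box d n) (cos_coef g h ^+ 2 + sin_coef g h ^+ 2).
Proof.
move=> [bg gE].
transitivity (\int[mu]_x \sum_(h <- box d n)
    (cos_coef g h * (g x * cosT h x) + sin_coef g h * (g x * sinT h x))).
  apply: eq_Rintegral => x _; rewrite {2}gE mulr_sumr.
  by apply: eq_bigr => h _; ring.
have bc h : bdd_measurable (fun x => g x * cosT h x) by apply: bmM => //; exact: bm_cosT.
have bs h : bdd_measurable (fun x => g x * sinT h x) by apply: bmM => //; exact: bm_sinT.
rewrite expect_sum; last by move=> h; apply: bmD; exact: bmZ.
by apply: eq_bigr => h _; rewrite expectD ?expectZ//; exact: bmZ.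
Qed.

(** The zero frequency cancels between the two measures; Cauchy-Schwarz
    handles the others, and Parseval bounds the coefficients by the sup norm. *)
Lemma trigpoly_discrepancy (nu : probability T R) n g e : trigpoly n g ->
  (forall x, `|g x| <= e) ->
  `|\int[nu]_x g x - \int[mu]_x g x| <=
    e * Num.sqrt (\sum_(h <- box d n | h != 0) fourier_sq nu h).
Proof.
move=> tg ge.
have e0 : 0 <= e by exact: le_trans (ge 0).
have -> : \int[nu]_x g x - \int[mu]_x g x = \sum_(h <- box d n | h != 0)
    (cos_coef g h * \int[nu]_x cosT h x + sin_coef g h * \int[nu]_x sinT h x).
  rewrite (trigpoly_integral nu tg) (bigD1_seq 0) ?box0 ?box_uniq//=.
  have c0 : \int[nu]_x cosT 0 x = 1.
    by under eq_Rintegral do rewrite cosT0l; rewrite expect_cst.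
  have s0 : \int[nu]_x sinT 0 x = 0.
    by under eq_Rintegral do rewrite sinT0l; rewrite expect_cst.
  rewrite c0 s0 mulr1 mulr0 addr0 /cos_coef.
  have -> : \int[mu]_x (g x * cosT 0 x) = \int[mu]_x g x.
    by apply: eq_Rintegral => x _; rewrite cosT0l mulr1.
  by rewrite addrAC subrr add0r.
set S := \sum_(h <- _ | _) _; set V := \sum_(h <- _ | _) _.
have V0 : 0 <= V by apply: sumr_ge0 => h _; rewrite addr_ge0// sqr_ge0.
rewrite -ler_sqr ?nnegrE ?mulr_ge0 ?sqrtr_ge0// real_normK ?num_real//.
rewrite exprMn sqr_sqrtr//.
apply: (le_trans (sum_cauchy_schwarz _ _ _ _ _ _)); rewrite ler_wpM2r//.
have := trigpoly_parseval tg; rewrite (bigD1_seq 0) ?box0 ?box_uniq//= => P.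
apply: (@le_trans _ _ (\int[mu]_x (g x * g x))).
  by rewrite P lerDr addr_ge0// sqr_ge0.
apply: expect_le_cst => [|x]; first by apply: bmM; exact: tg.1.
by rewrite -expr2 -[leLHS]real_normK ?num_real// ler_sqr ?nnegrE.
Qed.

End TrigPoly.

(** * Two-sided bounds on 1 - cos *)

Section TrigBounds.
Variable R : realType.
Implicit Types x t : R.

Lemma sin_mvt (a b : R) : a < b ->
  exists2 c, a < c < b & sin b - sin a = cos c * (b - a).
Proof.
move=> ab; have [|c] := @MVT R sin cos a b ab.
  by apply: continuous_subspaceT => x; exact: continuous_sin.
by rewrite in_itv/= => cab cE; exists c.
Qed.

Lemma norm_sin_le x : 0 <= x -> `|sin x| <= x.
Proof.
rewrite le_eqVlt => /predU1P[<-|x0]; first by rewrite sin0 normr0.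
have [c _] := sin_mvt x0; rewrite sin0 !subr0 => ->.
by rewrite normrM (gtr0_norm x0) ler_piMl ?cos_max// ltW.
Qed.

(** If sin were below its chord at [x], the mean slopes before and after
    [x] would contradict that cos decreases. *)
Lemma jordan_sin x : 0 <= x <= pi / 2 -> x * 2 / pi <= sin x.
Proof.
have pi0 := @pi_gt0 R.
move=> /andP[]; rewrite le_eqVlt => /predU1P[<-|x0].
  by rewrite !mul0r sin0.
rewrite le_eqVlt => /predU1P[->|xpi].
  by rewrite sin_pihalf divfK// divff// gt_eqF.
rewrite leNgt (_ : x * 2 / pi = 2 / pi * x); last by ring.
apply/negP => sx.
have [a /andP[a0 ax]] := sin_mvt x0; rewrite sin0 !subr0 => aE.
have [b /andP[xb bpi]] := sin_mvt xpi; rewrite sin_pihalf => bE.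
have ca : cos a < 2 / pi by rewrite -(ltr_pM2r x0) -aE.
have cb : 2 / pi < cos b.
  have h0 : 0 < pi / 2 - x by rewrite subr_gt0.
  rewrite -(ltr_pM2r h0) -bE mulrBr.
  have -> : 2 / pi * (pi / 2) = 1 :> R by rewrite mulrA divfK ?divff ?gt_eqF.
  by rewrite ltrD2l ltrN2.
have := lt_trans ca cb; rewrite ltNge => /negP; apply.
rewrite ltW// ltr_cos ?in_itv/=; lra.
Qed.

Lemma one_sub_cos x : 1 - cos (x *+ 2) = 2 * sin x ^+ 2.
Proof. by rewrite cos_mulr2n sin2cos2; lra. Qed.

Lemma one_sub_cos_turn_ge t : `|t| <= 1 / 2 -> 8 * t ^+ 2 <= 1 - cos (turn t).
Proof.
move=> th; have pi0 := @pi_gt0 R.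
have -> : cos (turn t) = cos ((pi * `|t|) *+ 2).
  rewrite -[in LHS]cos_norm /turn normrM (ger0_norm (mulrn_wge0 _ (ltW pi0))).
  by congr cos; rewrite mulrC mulrnAl.
rewrite one_sub_cos -[t ^+ 2]real_normK ?num_real//.
have t0 := normr_ge0 t.
have J : 2 * `|t| <= sin (pi * `|t|).
  have -> : 2 * `|t| = pi * `|t| * 2 / pi.
    by rewrite -[pi * _ * 2]mulrA mulrAC divff ?gt_eqF// mul1r mulrC.
  apply: jordan_sin; rewrite mulr_ge0//=; last exact: ltW.
  by rewrite ler_pM2l//; lra.
have : (2 * `|t|) ^+ 2 <= sin (pi * `|t|) ^+ 2 by rewrite ler_sqr ?nnegrE//; lra.
by rewrite exprMn; lra.
Qed.

Lemma one_sub_cos_le x : 0 <= x -> 1 - cos x <= x ^+ 2 / 2.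
Proof.
move=> x0; have {1}-> : x = (x / 2) *+ 2 by rewrite -mulr_natr; lra.
rewrite one_sub_cos -[sin _ ^+ 2]real_normK ?num_real//.
have x20 : 0 <= x / 2 by lra.
have : `|sin (x / 2)| ^+ 2 <= (x / 2) ^+ 2 by rewrite ler_sqr ?nnegrE//; exact: norm_sin_le.
by lra.
Qed.

End TrigBounds.

(** * The Fejer-Korovkin kernel *)

Section Kernel.
Variables (R : realType) (d n : nat).
Hypothesis n0 : (0 < n)%N.
Local Notation T := (torus R d).
Local Notation V := {ffun 'I_d -> 'I_n}.
Implicit Types (v w : V) (x y z : T).

(** This majorant of the squared distance is a trigonometric polynomial of
    degree 1, so its average against a kernel only depends on the Fourier
    coefficients of the kernel at the unit vectors. *)
Lemma torus_dist_sq_le x y :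
  8 * torus_dist x y ^+ 2 <= \sum_j (1 - cosT (delta_mx 0 j) (x - y)).
Proof.
have [w wE wj] := reduced_lift (x - y).
apply: (@le_trans _ _ (8 * enorm w ^+ 2)).
  by rewrite ler_wpM2l// ler_sqr ?nnegrE ?torus_dist_ge0 ?enorm_ge0// torus_dist_le.
rewrite sqr_enorm mulr_sumr; apply: ler_sum => j _.
by rewrite -wE cosT_pi delta_dotp; exact: one_sub_cos_turn_ge.
Qed.

Definition angle : R := pi / n.+1%:R.

(** Zero at -1 and at [n], hence the principal eigenvector of the discrete
    Laplacian on [0, n) with Dirichlet boundary conditions. *)
Definition profile (z : int) : R := sin (angle * (z + 1)%:~R).
Definition weight v : R := \prod_j profile (v j : nat).
Definition freq v : 'rV[int]_d := \row_j (v j : nat)%:Z.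
Definition mass : R := \sum_v weight v ^+ 2.

(** The squared modulus of the exponential sum with coefficients [weight],
    normalized to have integral 1. *)
Definition fejer_kernel z : R :=
  ((\sum_v weight v * cosT (freq v) z) ^+ 2 +
   (\sum_v weight v * sinT (freq v) z) ^+ 2) / mass.

Lemma profile_gt0 (a : 'I_n) : 0 < profile (a : nat).
Proof.
have n1 : 0 < n.+1%:R :> R by rewrite ltr0n.
apply: sin_gt0_pi; rewrite /angle -PoszD addn1 -pmulrn mulrAC.
rewrite divr_gt0 ?mulr_gt0 ?pi_gt0//=.
by rewrite ltr_pdivrMr// ltr_pM2l ?pi_gt0// ltr_nat ltnS.
Qed.

Lemma weight_gt0 v : 0 < weight v.
Proof. by apply: prodr_gt0 => j _; exact: profile_gt0. Qed.

Lemma mass_gt0 : 0 < mass.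
Proof.
rewrite /mass (bigD1 [ffun => Ordinal n0])//= ltr_pwDl ?exprn_gt0 ?weight_gt0//.
by apply: sumr_ge0 => v _; exact: sqr_ge0.
Qed.

Lemma fejer_kernel_ge0 z : 0 <= fejer_kernel z.
Proof. by rewrite divr_ge0 ?(ltW mass_gt0)// addr_ge0// sqr_ge0. Qed.

(** The range of [z] extends one step beyond the summation range at both
    ends, where [profile] is zero. *)
Lemma sum_profile (z : int) : -1 <= z <= n%:Z ->
  \sum_(a < n) profile (a : nat) * ((a : nat)%:Z == z)%:R = profile z.
Proof.
move=> /andP[zl zn].
have [z1|z1] := eqVneq z (- 1).
  rewrite z1 {2}/profile addNr mulr0 sin0 big1// => a _.
  by rewrite (_ : (_ == _) = false) ?mulr0//; apply/eqP; lia.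
have [zE|zE] := eqVneq z n%:Z.
  rewrite {2}/profile zE -PoszD addn1 -pmulrn /angle divfK ?pnatr_eq0// sinpi.
  rewrite big1// => a _; rewrite (_ : (_ == _) = false) ?mulr0//.
  by apply/eqP => aE; have := ltn_ord a; move: aE; move: (a : nat) => b; lia.
have zo : (`|z|%N < n)%N by lia.
rewrite (bigD1 (Ordinal zo))//= big1 => [|a az].
  by rewrite addr0 (_ : (_ == _) = true) ?mulr1; [congr profile; lia|apply/eqP; lia].
rewrite (_ : (_ == _) = false) ?mulr0//; apply: contraNF az => /eqP aE.
by apply/eqP/val_inj => /=; rewrite -aE.
Qed.

Lemma sum_weight (z : 'rV[int]_d) : (forall j, -1 <= z 0 j <= n%:Z) ->
  \sum_v weight v * (freq v == z)%:R = \prod_j profile (z 0 j).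
Proof.
move=> zb; under [RHS]eq_bigr => j _ do rewrite -sum_profile//.
rewrite bigA_distr_bigA/=; apply: eq_bigr => v _.
rewrite big_split/=; congr (_ * _).
have [vz|vz] := eqVneq (freq v) z.
  by rewrite big1// => j _; rewrite -vz mxE eqxx.
have [j vj] : exists j, (v j : nat)%:Z != z 0 j.
  apply/existsP; apply: contraNT vz; rewrite negb_exists => /forallP vz.
  by apply/eqP/rowP => j; rewrite mxE; have := vz j; rewrite negbK => /eqP.
by rewrite (bigD1 j)//= (negbTE vj) mul0r.
Qed.

Lemma profile_step (z : int) : profile (z + 1) + profile (z - 1) = 2 * cos angle * profile z.
Proof.
rewrite /profile !intrD mulrNz !(mulrDr angle) !mulrN !mulr1.
set t := angle * z%:~R.
rewrite (_ : t + angle + angle = (t + angle) + angle)// sinD.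
rewrite (_ : t - angle + angle = (t + angle) - angle); last by ring.
by rewrite sinB; ring.
Qed.

(** [weight] is an eigenvector of the sum of the two translations along an
    axis: the boundary terms vanish with [profile]. *)
Lemma weight_step v j : \sum_w weight w *
    ((freq w == freq v + delta_mx 0 j)%:R + (freq w == freq v - delta_mx 0 j)%:R) =
  2 * cos angle * weight v.
Proof.
under eq_bigr => w _ do rewrite mulrDr.
have vb i : (0 <= (v i : nat)%:Z <= n%:Z - 1).
  have := ltn_ord (v i); move: (nat_of_ord _) => k; lia.
have d01 i : ((0 : 'I_1) == 0) && (i == j) = (i == j) by rewrite eqxx.
rewrite big_split/= !sum_weight => [||i].
- have prodE (z : 'rV[int]_d) : (forall i, i != j -> z 0 i = (v i : nat)) ->
      \prod_i profile (z 0 i) =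
      profile (z 0 j) * \prod_(i | i != j) profile (v i : nat).
    move=> zv; rewrite (bigD1 j)//=; congr (_ * _).
    by apply: eq_bigr => i /zv ->.
  rewrite !prodE => [|i /negbTE ij|i /negbTE ij]; last 2 first.
  + by rewrite !mxE d01 ij addr0.
  + by rewrite !mxE d01 ij subr0.
  rewrite -mulrDl !mxE !eqxx/= profile_step /weight [in RHS](bigD1 j)//=.
  by rewrite mulrA.
- move=> i; rewrite !mxE d01; have := vb i.
  by case: (i == j); move: (Posz _) => k /=; lia.
- rewrite !mxE d01; have := vb i.
  by case: (i == j); move: (Posz _) => k /=; lia.
Qed.

End Kernel.

(** * Smoothing by the kernel *)

Section Smoothing.
Variables (R : realType) (d n : nat).
Hypothesis n0 : (0 < n)%N.
Local Notation T := (torus R d).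
Local Notation V := {ffun 'I_d -> 'I_n}.
Local Notation weight := (@weight R d n).
Local Notation mass := (@mass R d n).
Local Notation kernel := (@fejer_kernel R d n).
Local Notation angle := (angle R n).
Variable mu : probability T R.
Hypothesis mu_haar : is_haar mu.
Implicit Types (v w : V) (x y z : T) (f : T -> R).

Definition freqB v w := freq v - freq w.

Lemma kernelE z : kernel z =
  mass^-1 * \sum_v \sum_w weight v * weight w * cosT (freqB v w) z.
Proof.
rewrite /fejer_kernel mulrC; congr (_ * _); rewrite !expr2 !mulr_suml -big_split/=.
apply: eq_bigr => v _; rewrite !mulr_sumr -big_split/=; apply: eq_bigr => w _.
have := cosTM (freq v) (freq w) z; have := sinTM (freq v) (freq w) z.
set a := cosT (freq v) z; set b := cosT (freq w) z.
set a' := sinT (freq v) z; set b' := sinT (freq w) z => E1 E2.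
have -> : weight v * a * (weight w * b) + weight v * a' * (weight w * b') =
  weight v * weight w * (a * b + a' * b') by ring.
by rewrite E1 E2 /freqB; congr (_ * _); lra.
Qed.

Lemma bm_shift h x : bdd_measurable (fun y : T => cosT h (x - y)).
Proof.
have -> : (fun y : T => cosT h (x - y)) =
    (fun y => cosT h x * cosT h y + sinT h x * sinT h y).
  by apply/funext => y; rewrite cosTB.
by apply: bmD; apply: bmZ; [exact: bm_cosT|exact: bm_sinT].
Qed.

Lemma bm_kernel x : bdd_measurable (fun y : T => kernel (x - y)).
Proof.
under eq_fun do rewrite kernelE.
by apply: bmZ; apply: bm_sum => v; apply: bm_sum => w; apply: bmZ; exact: bm_shift.
Qed.

Lemma expect_cosT_shift h x : \int[mu]_y cosT h (x - (y : T)) = (h == 0)%:R.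
Proof.
under eq_Rintegral do rewrite cosTB.
rewrite expectD; [|by apply: bmZ; exact: bm_cosT|by apply: bmZ; exact: bm_sinT].
rewrite !expectZ; [|exact: bm_sinT|exact: bm_cosT].
rewrite expect_cosT// expect_sinT// mulr0 addr0.
by have [->|_] := eqVneq h 0; rewrite ?cosT0l ?mulr1// mulr0.
Qed.

Lemma expect_cosT_cosT_shift h h' x :
  \int[mu]_y (cosT h (x - (y : T)) * cosT h' (x - (y : T))) =
  ((h' == h)%:R + (h' == - h)%:R) / 2.
Proof.
under eq_Rintegral do rewrite cosTM mulrC.
rewrite expectZ ?expectD ?expect_cosT_shift;
  [|exact: bm_shift..|by apply: bmD; exact: bm_shift].
by rewrite subr_eq0 (addrC h h') addr_eq0 (eq_sym h h'); lra.
Qed.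

Lemma mass_neq0 : mass != 0.
Proof. by rewrite gt_eqF// mass_gt0. Qed.

Lemma expect_kernel x : \int[mu]_y kernel (x - (y : T)) = 1.
Proof.
under eq_Rintegral do rewrite kernelE.
have b v w : bdd_measurable (fun y : T => weight v * weight w * cosT (freqB v w) (x - y)).
  by apply: bmZ; exact: bm_shift.
have bs v : bdd_measurable
    (fun y : T => \sum_w weight v * weight w * cosT (freqB v w) (x - y)).
  exact: bm_sum.
rewrite expectZ; last exact: bm_sum.
rewrite expect_sum//; apply: (mulfI mass_neq0); rewrite mulrA divff ?mass_neq0// mul1r mulr1.
rewrite /mass; apply: eq_bigr => v _; rewrite expect_sum//.
under eq_bigr => w _.
  rewrite expectZ; last exact: bm_shift.
  rewrite expect_cosT_shift subr_eq0 eq_sym -mulrA; over.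
rewrite -mulr_sumr (sum_weight R n0) => [|j]; last first.
  rewrite mxE; have := ltn_ord (v j); move: (nat_of_ord _) => k; lia.
by rewrite expr2; congr (_ * _); apply: eq_bigr => j _; rewrite mxE.
Qed.

(** The Fourier coefficient of the kernel at a unit vector is the
    eigenvalue of [weight_step]. *)
Lemma expect_kernel_cos j x :
  \int[mu]_y (cosT (delta_mx 0 j) (x - (y : T)) * kernel (x - (y : T))) = cos angle.
Proof.
set e := delta_mx 0 j.
have b v w : bdd_measurable (fun y : T =>
    weight v * weight w * (cosT e (x - y) * cosT (freqB v w) (x - y))).
  by apply: bmZ; apply: bmM; exact: bm_shift.
have bs v : bdd_measurable (fun y : T =>
    \sum_w weight v * weight w * (cosT e (x - y) * cosT (freqB v w) (x - y))).
  exact: bm_sum.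
transitivity (\int[mu]_y (mass^-1 * \sum_v \sum_w
    weight v * weight w * (cosT e (x - (y : T)) * cosT (freqB v w) (x - (y : T))))).
  apply: eq_Rintegral => y _; rewrite kernelE mulrCA; congr (_ * _).
  rewrite mulr_sumr; apply: eq_bigr => v _; rewrite mulr_sumr; apply: eq_bigr => w _.
  by rewrite mulrCA.
rewrite expectZ; last exact: bm_sum.
rewrite expect_sum//; apply: (mulfI mass_neq0); rewrite mulrA divff ?mass_neq0// mul1r.
rewrite /mass mulr_suml; apply: eq_bigr => v _; rewrite expect_sum//.
transitivity (weight v / 2 * (2 * cos angle * weight v)); last by field.
rewrite -(weight_step R n0 v j) mulr_sumr; apply: eq_bigr => w _.
rewrite expectZ; last by apply: bmM; exact: bm_shift.
rewrite expect_cosT_cosT_shift -/e.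
have -> : (freqB v w == e) = (freq w == freq v - e).
  by rewrite /freqB subr_eq addrC -subr_eq eq_sym.
have -> : (freqB v w == - e) = (freq w == freq v + e).
  by rewrite /freqB subr_eq addrC -subr_eq opprK eq_sym.
by set p := (_ == _)%:R; set q := (_ == _)%:R; ring.
Qed.

Definition smooth f x := \int[mu]_y (f y * kernel (x - (y : T))).

Lemma smoothE f : bdd_measurable f -> smooth f =
  (fun x => mass^-1 * \sum_v \sum_w weight v * weight w *
    (cos_coef mu f (freqB v w) * cosT (freqB v w) x +
     sin_coef mu f (freqB v w) * sinT (freqB v w) x)).
Proof.
move=> bf; apply/funext => x.
have b v w : bdd_measurable (fun y : T => weight v * weight w *
    (f y * cosT (freqB v w) y * cosT (freqB v w) x +
     f y * sinT (freqB v w) y * sinT (freqB v w) x)).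
  apply: bmZ; apply: bmD; under eq_fun do rewrite mulrC; apply: bmZ; apply: bmM => //.
    exact: bm_cosT.
  exact: bm_sinT.
transitivity (\int[mu]_y (mass^-1 * \sum_v \sum_w weight v * weight w *
    (f y * cosT (freqB v w) y * cosT (freqB v w) x +
     f y * sinT (freqB v w) y * sinT (freqB v w) x))).
  apply: eq_Rintegral => y _; rewrite kernelE mulrCA; congr (_ * _).
  rewrite mulr_sumr; apply: eq_bigr => v _; rewrite mulr_sumr; apply: eq_bigr => w _.
  by rewrite cosTB; ring.
have bs v : bdd_measurable (fun y : T => \sum_w weight v * weight w *
    (f y * cosT (freqB v w) y * cosT (freqB v w) x +
     f y * sinT (freqB v w) y * sinT (freqB v w) x)).
  exact: bm_sum.
rewrite expectZ; last exact: bm_sum.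
congr (_ * _); rewrite expect_sum//; apply: eq_bigr => v _; rewrite expect_sum//.
apply: eq_bigr => w _.
have bc : bdd_measurable (fun y : T => f y * cosT (freqB v w) y).
  by apply: bmM => //; exact: bm_cosT.
have bss : bdd_measurable (fun y : T => f y * sinT (freqB v w) y).
  by apply: bmM => //; exact: bm_sinT.
rewrite expectZ; last by apply: bmD; under eq_fun do rewrite mulrC; exact: bmZ.
congr (_ * _); rewrite expectD; [|by under eq_fun do rewrite mulrC; exact: bmZ..].
rewrite mulrC [X in _ = _ + X]mulrC -!expectZ//.
by congr (_ + _); apply: eq_Rintegral => y _; rewrite mulrC.
Qed.

Lemma freqB_box N v w : (n <= N.+1)%N -> freqB v w \in box d N.
Proof.
move=> nN; rewrite mem_box; apply/forallP => j; rewrite !mxE.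
have := ltn_ord (v j); have := ltn_ord (w j).
move: (nat_of_ord _) (nat_of_ord _) => a b; rewrite ler_norml => *.
by apply/andP; split; lia.
Qed.

Lemma trigpoly_smooth N f : (n <= N.+1)%N -> bdd_measurable f ->
  trigpoly mu N (smooth f).
Proof.
move=> nN bf; rewrite smoothE//; apply: trigpolyZ.
apply: trigpoly_sum => // v; apply: trigpoly_sum => // w; apply: trigpolyZ.
by apply: trigpolyD; apply: trigpolyZ; [apply: trigpoly_cosT|apply: trigpoly_sinT];
  rewrite // freqB_box.
Qed.

Lemma angle_defect : 1 - cos angle <= 8 / n.+1%:R ^+ 2.
Proof.
have n1 : 0 < n.+1%:R :> R by rewrite ltr0n.
have a0 : 0 <= angle by rewrite /angle divr_ge0 ?pi_ge0// ltW.
apply: (le_trans (one_sub_cos_le a0)); rewrite /angle expr_div_n mulrAC.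
rewrite ler_pM2r ?invr_gt0 ?exprn_gt0//.
have : pi ^+ 2 <= 4 ^+ 2 :> R.
  rewrite ler_sqr ?nnegrE ?pi_ge0//.
  by have := @pihalf_lt2 R; lra.
by lra.
Qed.

(** The distance D is linearized by D <= N D^2 / 2 + 1 / (2 N) with
    N = n + 1, the value that balances the two terms. *)
Lemma expect_dist_kernel x :
  \int[mu]_y (torus_dist x (y : T) * kernel (x - (y : T))) <= d.+1%:R / n%:R.
Proof.
have bk := bm_kernel x.
have bc j : bdd_measurable (fun y : T => (1 - cosT (delta_mx 0 j) (x - y)) * kernel (x - y)).
  by apply: bmM => //; apply: bmB; [exact: bm_cst|exact: bm_shift].
(* The factor 8 of [torus_dist_sq_le] turns the coefficient N / 2 into N / 16. *)
pose N : R := n.+1%:R.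
have N0 : 0 < N by rewrite ltr0n.
have bg : bdd_measurable (fun y : T => N / 16 *
    (\sum_j (1 - cosT (delta_mx 0 j) (x - y)) * kernel (x - y)) + (2 * N)^-1 * kernel (x - y)).
  by apply: bmD; apply: bmZ => //; exact: bm_sum.
apply: (@le_trans _ _ (\int[mu]_y (N / 16 *
    (\sum_j (1 - cosT (delta_mx 0 j) (x - (y : T))) * kernel (x - (y : T)))
    + (2 * N)^-1 * kernel (x - (y : T))))).
  apply: le_expect => // [|y].
    by apply: bmM => //; exact: lip_bm (lip_dist x).
  rewrite -mulr_suml (mulrA (N / 16)) -mulrDl ler_wpM2r ?fejer_kernel_ge0//.
  have := torus_dist_sq_le x y.
  move: (torus_dist x y) (\sum_j _) => D S DS.
  have : N / 16 * (8 * D ^+ 2) <= N / 16 * S by rewrite ler_pM2l// divr_gt0.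
  have -> : N / 16 * (8 * D ^+ 2) = N / 2 * D ^+ 2 by field.
  have : 0 <= (N * D - 1) ^+ 2 / (2 * N) by rewrite divr_ge0 ?sqr_ge0// mulr_ge0// ltW.
  have -> : (N * D - 1) ^+ 2 / (2 * N) = N / 2 * D ^+ 2 - D + (2 * N)^-1.
    by field; rewrite gt_eqF.
  by move: (N / 2 * _) (N / 16 * _) ((2 * N)^-1) => a b c; lra.
rewrite expectD; [|by apply: bmZ; exact: bm_sum|exact: bmZ].
rewrite !expectZ//; last exact: bm_sum.
rewrite expect_kernel mulr1 expect_sum//.
have E1 j : \int[mu]_y ((1 - cosT (delta_mx 0 j) (x - (y : T))) * kernel (x - (y : T))) =
    1 - cos angle.
  under eq_Rintegral do rewrite mulrBl mul1r.
  by rewrite expectB ?expect_kernel ?expect_kernel_cos//; apply: bmM => //; exact: bm_shift.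
under eq_bigr do rewrite E1.
rewrite sumr_const card_ord -[(1 - cos angle) *+ d]mulr_natl.
apply: (@le_trans _ _ (N / 16 * (d%:R * (8 / N ^+ 2)) + (2 * N)^-1)).
  rewrite lerD2r; apply: ler_wpM2l; first by rewrite divr_ge0// ltW.
  by apply: ler_wpM2l => //; exact: angle_defect.
have -> : N / 16 * (d%:R * (8 / N ^+ 2)) + (2 * N)^-1 = d.+1%:R / (2 * N).
  by rewrite -natr1; field; rewrite gt_eqF.
rewrite ler_wpM2l// lef_pV2 ?posrE ?mulr_gt0 ?ltr0n//.
rewrite /N -natr1; have : 0 <= n%:R :> R by []; lra.
Qed.

Lemma smooth_close t f x : 0 <= t -> lip t f ->
  `|f x - smooth f x| <= t * (d.+1%:R / n%:R).
Proof.
move=> t0 lf; have bk := bm_kernel x; have bf := lip_bm lf.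
have -> : f x - smooth f x = \int[mu]_y ((f x - f y) * kernel (x - (y : T))).
  under [RHS]eq_Rintegral do rewrite mulrBl.
  by rewrite expectB ?expectZ ?expect_kernel ?mulr1//; [exact: bmZ|exact: bmM].
have bd : bdd_measurable (fun y : T => torus_dist x y * kernel (x - y)).
  by apply: bmM => //; exact: lip_bm (lip_dist x).
apply: (@le_trans _ _ (\int[mu]_y (t * (torus_dist x (y : T) * kernel (x - (y : T)))))).
  apply: norm_expect_le => [||y].
  - by apply: bmM => //; apply: bmB => //; exact: bm_cst.
  - exact: bmZ.
  rewrite normrM (ger0_norm (fejer_kernel_ge0 n0 _)) (mulrA t).
  by rewrite ler_wpM2r ?fejer_kernel_ge0// lip_norm.
by rewrite expectZ// ler_wpM2l// expect_dist_kernel.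
Qed.

End Smoothing.

(** * A dyadic smoothing inequality for the Wasserstein distance *)

Section SmoothingInequality.
Variables (R : realType) (d : nat).
Local Notation T := (torus R d).
Variable mu : probability T R.
Hypothesis mu_haar : is_haar mu.
Variable nu : probability T R.

Definition energy n := \sum_(h <- box d n | h != 0) fourier_sq nu h.

(** Telescoping over the smoothings of [f] at the degrees 2^l. *)
Lemma discrepancy_le t (f : T -> R) L : 0 <= t -> lip t f ->
  \int[nu]_x f x - \int[mu]_x f x <=
    d.+1%:R * (2 / (2 ^ L)%:R +
      \sum_(l < L) 2 / (2 ^ l)%:R * Num.sqrt (energy (2 ^ l.+1))) * t.
Proof.
move=> t0 lf; have bf := lip_bm lf.
have p0 l : (0 < 2 ^ l)%N by rewrite expn_gt0.
pose S l := smooth (2 ^ l) mu f.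
have tS l N : (2 ^ l <= N.+1)%N -> trigpoly mu N (S l).
  by move=> lN; apply: trigpoly_smooth.
have bS l : bdd_measurable (S l) by have [] := tS l (2 ^ l)%N (leqnSn _).
have close l x : `|f x - S l x| <= t * (d.+1%:R / (2 ^ l)%:R).
  exact: smooth_close.
pose D g := \int[nu]_x g x - \int[mu]_x g x.
have DB g g' : bdd_measurable g -> bdd_measurable g' ->
    D (fun x => g x - g' x) = D g - D g'.
  by move=> bg bg'; rewrite /D !expectB//; lra.
have Df : D f - D (S L) <= 2 * (t * (d.+1%:R / (2 ^ L)%:R)).
  rewrite -DB// /D.
  have := norm_expect_le_cst nu (bmB bf (bS L)) (close L).
  have := norm_expect_le_cst mu (bmB bf (bS L)) (close L).
  by rewrite !ler_norml => /andP[? ?] /andP[? ?]; lra.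
(* At degree 2 ^ 0 only the zero frequency occurs, so the smoothing is constant. *)
have D0 : D (S 0%N) = 0.
  have e0 x : `|S 0%N x| <= `|f x| + t * (d.+1%:R / (2 ^ 0)%:R).
    rewrite -[S 0%N x](subKr (f x)); apply: (le_trans (ler_normB _ _)).
    by rewrite lerD2l.
  have [M fM] := bf.2.
  have := trigpoly_discrepancy nu (tS 0%N 0%N isT)
    (fun x => le_trans (e0 x) (lerD (fM x) (lexx _))).
  rewrite big1_seq => [|h /andP[h0]]; last first.
    rewrite mem_box => /forallP hb; case/negP: h0; apply/eqP/rowP => j.
    by rewrite mxE; apply/eqP; rewrite -normr_le0.
  by rewrite sqrtr0 mulr0 normr_le0 => /eqP.
have DS l : D (S l.+1) - D (S l) <=
    2 * t * d.+1%:R / (2 ^ l)%:R * Num.sqrt (energy (2 ^ l.+1)).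
  rewrite -DB//; apply: (le_trans (ler_norm _)).
  apply: trigpoly_discrepancy => // [|x].
    have tN : trigpoly mu (2 ^ l.+1)%N (fun x => -1 * S l x).
      apply: trigpolyZ; apply: tS; rewrite (leq_trans _ (leqnSn _))//.
      by rewrite leq_exp2l.
    have := trigpolyD (tS l.+1 (2 ^ l.+1)%N (leqnSn _)) tN.
    by under eq_fun do rewrite mulN1r.
  have := close l x; have := close l.+1 x.
  have -> : S l.+1 x - S l x = (f x - S l x) - (f x - S l.+1 x) by ring.
  move=> c1 c0; apply: (le_trans (ler_normB _ _)).
  have c2 : t * (d.+1%:R / (2 ^ l.+1)%:R) <= t * (d.+1%:R / (2 ^ l)%:R) :> R.
    rewrite ler_wpM2l// ler_wpM2l// lef_pV2 ?posrE ?ltr0n// ler_nat.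
    by rewrite leq_exp2l.
  apply: (le_trans (lerD c0 (le_trans c1 c2))).
  by apply: eq_ler; ring.
have tele : D (S L) <= \sum_(l < L)
    2 * t * d.+1%:R / (2 ^ l)%:R * Num.sqrt (energy (2 ^ l.+1)).
  elim: L {Df} => [|L IH]; first by rewrite big_ord0 D0.
  rewrite big_ord_recr/=; apply: le_trans (lerD IH (DS L)).
  by rewrite addrC subrK.
have -> : d.+1%:R * (2 / (2 ^ L)%:R +
      \sum_(l < L) 2 / (2 ^ l)%:R * Num.sqrt (energy (2 ^ l.+1))) * t =
    2 * (t * (d.+1%:R / (2 ^ L)%:R)) + \sum_(l < L)
    2 * t * d.+1%:R / (2 ^ l)%:R * Num.sqrt (energy (2 ^ l.+1)).
  rewrite mulrDr mulrDl; congr (_ + _); first by ring.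
  by rewrite mulr_sumr mulr_suml; apply: eq_bigr => l _; ring.
by move: Df tele; rewrite /D; lra.
Qed.

(** A dyadic form of the classical bound by the square root of the sum of
    |hat nu(h)|^2 / |h|^2. *)
Theorem berry_esseen_smoothing L :
  (wasserstein1 nu mu <= (d.+1%:R * (2 / (2 ^ L)%:R +
      \sum_(l < L) 2 / (2 ^ l)%:R * Num.sqrt (energy (2 ^ l.+1))))%:E)%E.
Proof. by apply: kantorovich_le => t f t0 lf; exact: discrepancy_le. Qed.

End SmoothingInequality.

Section Convolution.
Variables (R : realType) (d : nat).
Local Notation T := (torus R d).
Implicit Types (nu : probability T R) (f g : T -> R) (h : 'rV[int]_d).

Lemma bm_comp_measurable disp disp' (A : measurableType disp) (B : measurableType disp')
    (phi : A -> B) (f : B -> R) : measurable_fun setT phi ->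
  bdd_measurable f -> bdd_measurable (f \o phi).
Proof.
move=> mphi [mf [M fM]]; split; last by exists M => x; exact: fM.
exact: measurableT_comp.
Qed.

Lemma expect_prod nu1 nu2 f g : bdd_measurable f -> bdd_measurable g ->
  Rintegral (nu1 \x nu2)%E setT (fun z : T * T => f z.1 * g z.2) =
  (\int[nu1]_x f x) * (\int[nu2]_x g x).
Proof.
move=> bf bg.
have bfg : bdd_measurable (fun z : T * T => f z.1 * g z.2).
  by apply: bmM; [exact: (bm_comp_measurable measurable_fst)|
                  exact: (bm_comp_measurable measurable_snd)].
rewrite [LHS]/Rintegral -(integral12_prod_meas1 (bm_integrable _ bfg)).
rewrite /fubini_F/=.
under eq_integral => x _.
  rewrite bm_RintegralE; last exact: bmZ.
  rewrite expectZ// mulrC; over.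
by rewrite bm_RintegralE ?expectZ//= 1?mulrC//; exact: bmZ.
Qed.

Lemma expect_torus_conv nu1 nu2 f : bdd_measurable f ->
  \int[torus_conv nu1 nu2]_x f x =
  Rintegral (nu1 \x nu2)%E setT (fun z : T * T => f (z.1 + z.2)).
Proof.
move=> bf; congr fine; rewrite integral_distribution//.
- by apply/measurable_EFinP; exact: bf.1.
- apply: bm_integrable; apply: bm_comp_measurable bf.
  exact: measurable_torus_add.
Qed.

Lemma fourier_sq_conv nu1 nu2 h :
  fourier_sq (torus_conv nu1 nu2) h = fourier_sq nu1 h * fourier_sq nu2 h.
Proof.
have bc := bm_cosT (R := R) h; have bs := bm_sinT (R := R) h.
have bp f g : bdd_measurable f -> bdd_measurable g ->
    bdd_measurable (fun z : T * T => f z.1 * g z.2).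
  by move=> bf bg; apply: bmM; [exact: (bm_comp_measurable measurable_fst)|
                  exact: (bm_comp_measurable measurable_snd)].
rewrite /fourier_sq !expect_torus_conv//.
have -> : (fun z : T * T => cosT h (z.1 + z.2)) =
    (fun z => cosT h z.1 * cosT h z.2 - sinT h z.1 * sinT h z.2).
  by apply/funext => z; rewrite cosTD.
have -> : (fun z : T * T => sinT h (z.1 + z.2)) =
    (fun z => sinT h z.1 * cosT h z.2 + cosT h z.1 * sinT h z.2).
  by apply/funext => z; rewrite sinTD.
by rewrite expectB ?expectD ?expect_prod//; [ring|exact: bp..].
Qed.

Lemma fourier_sq_dirac0 h : fourier_sq (dirac (0 : T) : probability T R) h = 1.
Proof.
have E f : bdd_measurable f -> \int[dirac (0 : T)]_x f x = f 0.
  move=> bf; rewrite /Rintegral integral_dirac ?diracT ?mul1e//.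
  by apply/measurable_EFinP; exact: bf.1.
rewrite /fourier_sq !E; [|exact: bm_sinT|exact: bm_cosT].
by rewrite cosT0 sinT0 expr1n expr0n addr0.
Qed.

Lemma fourier_sq_conv_pow nu k h :
  fourier_sq (torus_conv_pow nu k) h = fourier_sq nu h ^+ k.
Proof.
elim: k => [|k IH]; first by rewrite fourier_sq_dirac0.
by rewrite /torus_conv_pow iterS fourier_sq_conv -/(torus_conv_pow nu k) IH exprS.
Qed.

Lemma atom_le_expect nu f x : bdd_measurable f -> (forall y, 0 <= f y) ->
  measurable [set x] -> fine (nu [set x]) * f x <= \int[nu]_y f y.
Proof.
move=> bf f0 mx; rewrite mulrC -(expect_indic nu mx) -expectZ; last exact: bm_indic.
apply: le_expect => // [|y]; first by apply: bmZ; exact: bm_indic.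
rewrite indicE; have [/set_mem ->|_] := boolP (y \in [set x]); first by rewrite mulr1.
by rewrite mulr0.
Qed.

Lemma torus_set1_measurable (x : T) : measurable [set x].
Proof.
rewrite -[[set x]]setCK; apply: measurableC; apply: sub_sigma_algebra.
have -> : ~` [set x] = [set y | 0 < torus_dist x y].
  apply/seteqP; split=> y /=; last by move=> xy yx; rewrite yx torus_distxx ltxx in xy.
  move=> yx; rewrite lt_def torus_dist_ge0 andbT; apply/eqP => /torus_dist_positivity xy.
  by apply: yx.
have /continuousP co := lip_continuous (lip_dist x).
by apply: (co [set r | 0 < r]); exact: open_gt.
Qed.

(** The right-hand side is the double integral of the nonnegative function
    1 - cos (2 pi <h, z - w>), and the left-hand side is the part of it carried
    by the pair of atoms. *)
Lemma fourier_sq_atoms nu h x y :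
  fine (nu [set x]) * (fine (nu [set y]) * (1 - cosT h (x - y))) <= 1 - fourier_sq nu h.
Proof.
have bc := bm_cosT (R := R) h; have bs := bm_sinT (R := R) h.
set a := \int[nu]_z cosT h z; set b := \int[nu]_z sinT h z.
pose G z := 1 - (cosT h z * a + sinT h z * b).
have bG : bdd_measurable G.
  apply: bmB; first exact: bm_cst.
  by apply: bmD; under eq_fun do rewrite mulrC; exact: bmZ.
have GE z : G z = \int[nu]_w (1 - cosT h (z - (w : T))).
  under eq_Rintegral do rewrite cosTB.
  rewrite expectB ?expect_cst; [|exact: bm_cst|by apply: bmD; exact: bmZ].
  by rewrite expectD ?expectZ//; exact: bmZ.
have bk (z : T) : bdd_measurable (fun w : T => 1 - cosT h (z - w)).
  by apply: bmB; [exact: bm_cst|exact: bm_shift].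
have k0 (z w : T) : 0 <= 1 - cosT h (z - w) by rewrite subr_ge0 cos_le1.
have G0 z : 0 <= G z.
  by rewrite GE; apply: Rintegral_ge0.
have -> : 1 - fourier_sq nu h = \int[nu]_z G z.
  rewrite expectB; [|exact: bm_cst|by apply: bmD; under eq_fun do rewrite mulrC; exact: bmZ].
  rewrite expect_cst /fourier_sq -/a -/b; congr (_ - _).
  rewrite expectD; [|by under eq_fun do rewrite mulrC; exact: bmZ..].
  by congr (_ + _); under eq_Rintegral do rewrite mulrC; rewrite expectZ// expr2.
apply: le_trans (atom_le_expect nu (x := x) bG G0 (torus_set1_measurable x)).
rewrite ler_wpM2l ?fine_ge0// GE.
exact: (atom_le_expect nu (bk x) (k0 x) (torus_set1_measurable y)).
Qed.

Lemma fourier_sq_ge0 nu h : 0 <= fourier_sq nu h.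
Proof. by rewrite addr_ge0// sqr_ge0. Qed.

End Convolution.

(** * Fourier decay of one step *)

Section DistInt.
Variable R : realType.
Implicit Types (x y : R).

Lemma dist_int_le x (n : int) : dist_int x <= `|x - n%:~R|.
Proof. by apply: ge_inf; [exists 0 => _ [m _ <-]|exists n]. Qed.

Lemma dist_int_ge x c : (forall n : int, c <= `|x - n%:~R|) -> c <= dist_int x.
Proof.
move=> H; apply: lb_le_inf; first by exists `|x - 0%:~R|, 0.
by move=> _ [n _ <-].
Qed.

Lemma dist_int_ge0 x : 0 <= dist_int x.
Proof. exact: dist_int_ge. Qed.

Definition centered x : R := x - (Num.floor (x + 1 / 2))%:~R.

Lemma norm_centered_le x : `|centered x| <= 1 / 2.
Proof.
rewrite /centered ler_norml.
have := floor_le (x + 1 / 2); have := floorD1_gt (x + 1 / 2).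
by rewrite intrD; move: (_%:~R) => m *; apply/andP; split; lra.
Qed.

Lemma dist_intE x : dist_int x = `|centered x|.
Proof.
apply/eqP; rewrite eq_le dist_int_le/=; apply: dist_int_ge => n.
have := norm_centered_le x; rewrite /centered; set m := Num.floor _ => hm.
have [->//|mn] := eqVneq n m.
have : 1 <= `|(n - m)%:~R : R|.
  by rewrite -intr_norm -[1]/(1%:~R) ler_int -gtz0_ge1 normr_gt0 subr_eq0.
have := ler_normB (x - m%:~R) (x - n%:~R).
have -> : x - m%:~R - (x - n%:~R) = (n - m)%:~R by rewrite intrD mulrNz; ring.
by lra.
Qed.

Lemma dist_intN x : dist_int (- x) = dist_int x.
Proof.
have le y : dist_int (- y) <= dist_int y.
  apply: dist_int_ge => n; have := dist_int_le (- y) (- n).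
  by rewrite mulrNz opprK addrC distrC.
by apply/eqP; rewrite eq_le le -{1}[x]opprK le.
Qed.

Lemma dist_int_natM (N : nat) x : dist_int (N%:R * x) <= N%:R * dist_int x.
Proof.
have -> : N%:R * dist_int x = `|N%:R * centered x|.
  by rewrite normrM ger0_norm ?dist_intE.
have := dist_int_le (N%:R * x) (N%:Z * Num.floor (x + 1 / 2)).
by rewrite intrM -pmulrn -mulrBr.
Qed.

Lemma one_sub_cos_turn_dist x : 8 * dist_int x ^+ 2 <= 1 - cos (turn x).
Proof.
rewrite dist_intE real_normK ?num_real//.
have -> : cos (turn x) = cos (turn (centered x)).
  by rewrite -(cos_turnDz (centered x) (Num.floor (x + 1 / 2))) subrK.
exact: one_sub_cos_turn_ge (norm_centered_le x).
Qed.

End DistInt.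

Section IntegerLaws.
Variable R : realType.

Lemma int_null (m : probability int R) (A : set int) :
  (forall n, A n -> m [set n] = 0%E) -> m A = 0%E.
Proof.
move=> A0.
pose F k : set int := if unpickle k is Some n then [set n] `&` A else set0.
have FA : A = \bigcup_k F k.
  apply/seteqP; split=> [n An|n [k _]]; last by rewrite /F; case: unpickle => // ? [].
  by exists (pickle n) => //; rewrite /F pickleK.
suff : m.-negligible (\bigcup_k F k) by rewrite -FA => /negligibleP; apply.
apply: negligible_bigcup => k; rewrite /F; case: unpickle => [n|]; last exact: negligible_set0.
apply/negligibleP => //; have [An|An] := pselect (A n).
  by rewrite setIidl => [|_ ->//]; exact: A0.
by rewrite (_ : _ `&` _ = set0) ?measure0// -subset0 => _ [/= ->].
Qed.

(** Otherwise the law would be carried by one point or by none, because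
    the integers are countable. *)
Lemma two_atoms (m : probability int R) :
  (forall n : int, m (~` [set n]) <> 0%E) ->
  exists a, exists b, [/\ a != b, (0 < m [set a])%E & (0 < m [set b])%E].
Proof.
move=> H; apply: contrapT => N.
have gt0 n : m [set n] <> 0%E -> (0 < m [set n])%E.
  by move=> /eqP mn; rewrite lt_def mn measure_ge0.
have [[a ma]|Na] := pselect (exists a, m [set a] <> 0%E).
  apply: (H a); apply: int_null => b /= /eqP ba; apply: contrapT => mb.
  by apply: N; exists b, a; split=> //; exact: gt0.
have : m setT = 0%E.
  by apply: int_null => n _; apply: contrapT => mn; apply: Na; exists n.
by rewrite probability_setT => /eqP; rewrite onee_eq0.
Qed.

End IntegerLaws.

Section StepLaw.
Local Open Scope quotient_scope.
Context {disp : measure_display} {Omega : measurableType disp} {R : realType}.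
Context {P : probability Omega R} {d r : nat}.
Variables (alpha : 'I_r.+1 -> 'rV[R]_d).
Variables (xi : 'I_r.+1 -> {RV P >-> int}) (I : {RV P >-> 'I_r.+1}).
Hypothesis ind : independent_family xi I.
Local Notation T := (torus R d).

Lemma joint_event i n :
  P ((I @^-1` [set i]) `&` (xi i @^-1` [set n])) =
  (P (I @^-1` [set i]) * P (xi i @^-1` [set n]))%E.
Proof.
pose E (j : option 'I_r.+1) := if j is Some _ then xi i @^-1` [set n] else I @^-1` [set i].
have F0 (j : option 'I_r.+1) : j \in [set None; Some i]%SET ->
    (if j is Some i0 then g_sigma_algebra_preimage (xi i0)
     else g_sigma_algebra_preimage I) (E j).
  rewrite !inE => /orP[] /eqP -> /=; [exists [set i] => //|exists [set n] => //];
  by rewrite setTI.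
have := ind F0; rewrite big_setU1 ?inE//= big_set1 => <-; congr (P _).
apply/seteqP; split=> [w [wi wn] j /=|w wE].
  by rewrite !inE => /orP[] /eqP ->.
by split; [apply: (wE None)|apply: (wE (Some i))]; rewrite /= !inE eqxx ?orbT.
Qed.

(** Equality may fail: distinct integer multiples of the [alpha i] can meet
    on the torus. *)
Lemma step_atom_ge i n :
  fine (distribution P I [set i]) * fine (distribution P (xi i) [set n]) <=
  fine (distribution P (random_step alpha xi I) [set \pi_T (alpha i *~ n)]).
Proof.
rewrite -fineM; [|exact: fin_num_measure..].
have mI : measurable (I @^-1` [set i]).
  by rewrite -[X in measurable X]setTI; exact: measurable_funPT.
have mxi : measurable (xi i @^-1` [set n]).
  by rewrite -[X in measurable X]setTI; exact: measurable_funPT.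
have mx := torus_set1_measurable (\pi_T (alpha i *~ n)).
apply: fine_le; [by rewrite fin_numM//; exact: fin_num_measure|exact: fin_num_measure|].
rewrite -[leLHS]joint_event; apply: le_measure; rewrite ?inE.
- exact: measurableI.
- by rewrite -[X in measurable X]setTI; exact: measurable_random_step.
by move=> w [/= wi wn]; rewrite /random_step wi wn.
Qed.

(** The atoms at [a] and [b] see the frequency only through
    (a - b) <h, alpha_i>. Passing to a multiple [Q] of [a - b] lets one [Q]
    serve all the indices. *)
Lemma step_fourier_decay i (a b : int) (Q : nat) h : a != b ->
  (`|a - b|%N %| Q)%N -> (0 < Q)%N ->
  8 * (fine (distribution P I [set i]) ^+ 2 *
    fine (distribution P (xi i) [set a]) * fine (distribution P (xi i) [set b])) / Q%:R ^+ 2 *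
    dist_int (dotp (Q%:Z *: h) (alpha i)) ^+ 2 <=
    1 - fourier_sq (distribution P (random_step alpha xi I)) h.
Proof.
move=> ab abQ Q0; set nu := distribution P (random_step alpha xi I).
apply: le_trans (fourier_sq_atoms nu h (\pi_T (alpha i *~ a)) (\pi_T (alpha i *~ b))).
have := step_atom_ge i a; have := step_atom_ge i b; rewrite -/nu.
set p := fine (distribution P I [set i]).
set u := fine (distribution P (xi i) [set a]).
set v := fine (distribution P (xi i) [set b]).
set x := fine (nu [set \pi_T (alpha i *~ a)]).
set y := fine (nu [set \pi_T (alpha i *~ b)]).
rewrite -pi_torusB -mulrzBr cosT_pi dotpMz dotpZl.
set t := dotp h (alpha i) => yv xu.
have p0 : 0 <= p by exact: fine_ge0.
have u0 : 0 <= u by exact: fine_ge0.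
have v0 : 0 <= v by exact: fine_ge0.
have QR : 0 < Q%:R :> R by rewrite ltr0n.
set s := 1 - cos _.
have s0 : 0 <= s by rewrite subr_ge0 cos_le1.
have sE : 8 * dist_int (Q%:~R * t) ^+ 2 / Q%:R ^+ 2 <= s.
  apply: le_trans (one_sub_cos_turn_dist _); rewrite -mulrA ler_pM2l//.
  rewrite ler_pdivrMr ?exprn_gt0// [leRHS]mulrC -exprMn.
  rewrite ler_sqr ?nnegrE ?mulr_ge0 ?dist_int_ge0//.
  have /dvdnP[m QE] := abQ.
  have -> : dist_int ((a - b)%:~R * t) = dist_int (`|a - b|%N%:R * t).
    rewrite pmulrn abszE intr_norm; have [_|_] := ger0P ((a - b)%:~R : R) => //.
    by rewrite mulNr dist_intN.
  have -> : Q%:~R * t = m%:R * (`|a - b|%N%:R * t) by rewrite mulrA -natrM -QE pmulrn.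
  apply: (le_trans (dist_int_natM _ _)); rewrite ler_wpM2r ?dist_int_ge0// ler_nat.
  by rewrite QE leq_pmulr// absz_gt0 subr_eq0.
apply: (@le_trans _ _ (p * u * (p * v * s))); last first.
  by apply: ler_pM => //; rewrite ?mulr_ge0// ler_wpM2r.
rewrite (_ : _ * _ = p ^+ 2 * u * v *
  (8 * dist_int (Q%:~R * t) ^+ 2 / Q%:R ^+ 2)); last by ring.
rewrite (_ : p * u * _ = p ^+ 2 * u * v * s); last by ring.
by rewrite ler_wpM2l// !mulr_ge0.
Qed.

End StepLaw.

(** * Sums over separated frequencies *)

Section Counting.
Variables (R : realType) (H : eqType) (r : nat).
Variables (s : seq H) (z : H -> 'I_r.+1 -> R) (delta rho : R).
Hypotheses (us : uniq s) (delta0 : 0 < delta) (rho0 : 0 <= rho) (rho1 : rho < 1).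
Hypothesis z_bdd : forall h i, `|z h i| <= 1 / 2.
Hypothesis sep : {in s &, forall h h', h != h' ->
  exists i, delta <= `|z h i - z h' i|}.

Definition cell_index (h : H) (i : 'I_r.+1) : nat := Num.truncn (`|z h i| / delta).

Lemma cell_indexP h i :
  (cell_index h i)%:R * delta <= `|z h i| < (cell_index h i).+1%:R * delta.
Proof.
have z0 : 0 <= `|z h i| / delta by rewrite divr_ge0// ltW.
have /andP[l u] := truncn_itv z0.
by rewrite -ler_pdivlMr// l /= -ltr_pdivrMr.
Qed.

(** Two points with the same signs and the same [cell_index] in all
    coordinates are closer than [delta], so these data determine the point. The
    sum is therefore at most a product of geometric series, each doubled by the
    choice of the sign. *)
Lemma separated_sum_le :
  \sum_(h <- s) \prod_i rho ^+ cell_index h i <= (2 / (1 - rho)) ^+ r.+1.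
Proof.
pose B := Num.truncn (1 / 2 / delta).
have cB h i : (cell_index h i < B.+1)%N.
  rewrite ltnS; apply: le_truncn.
  by rewrite ler_pM2r ?invr_gt0.
pose phi h : {ffun 'I_r.+1 -> bool * 'I_B.+1} :=
  [ffun i => (0 <= z h i, inord (cell_index h i))].
pose W (u : {ffun 'I_r.+1 -> bool * 'I_B.+1}) : R := \prod_i rho ^+ (u i).2.
have W0 u : 0 <= W u by apply: prodr_ge0 => i _; exact: exprn_ge0.
(* Equal signs make | |z| - |z'| | the distance between z and z'. *)
have phi_inj : {in s &, injective phi}.
  move=> h h' hs h's /ffunP E; apply/eqP/negPn/negP => hh'.
  have [i] := sep hs h's hh'; rewrite leNgt => /negP; apply.
  have := E i; rewrite !ffunE => -[sgn /(congr1 val)]/=; rewrite !inordK// => cE.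
  have /andP[l1 u1] := cell_indexP h i; have /andP[l2 u2] := cell_indexP h' i.
  rewrite cE -natr1 mulrDl mul1r in l1 u1; rewrite -natr1 mulrDl mul1r in u2.
  have zz : `| `|z h i| - `|z h' i| | < delta.
    by rewrite ltr_norml; apply/andP; split; lra.
  have [z1|z1] := leP 0 (z h i).
    have z2 : 0 <= z h' i by rewrite -sgn.
    by rewrite (ger0_norm z1) (ger0_norm z2) in zz.
  have z2 : z h' i < 0 by rewrite ltNge -sgn -ltNge.
  rewrite (ltr0_norm z1) (ltr0_norm z2) in zz.
  by rewrite opprK addrC distrC in zz.
have -> : \sum_(h <- s) \prod_i rho ^+ cell_index h i = \sum_(u <- map phi s) W u.
  rewrite big_map; apply: eq_bigr => h _; apply: eq_bigr => i _.
  by rewrite ffunE/= inordK.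
have uphi : uniq (map phi s) by rewrite map_inj_in_uniq.
rewrite big_uniq//=.
apply: (@le_trans _ _ (\sum_u W u)).
  by rewrite big_mkcond; apply: ler_sum => u _; case: ifP.
rewrite -(bigA_distr_bigA (fun _ (p : bool * 'I_B.+1) => rho ^+ p.2))/=.
rewrite prodr_const card_ord; apply: lerXn2r; rewrite ?nnegrE.
- by apply: sumr_ge0 => p _; exact: exprn_ge0.
- by rewrite divr_ge0// subr_ge0 ltW.
have -> : \sum_(p : bool * 'I_B.+1) rho ^+ p.2 = 2 * \sum_(m < B.+1) rho ^+ m.
  rewrite -(pair_bigA _ (fun (_ : bool) (m : 'I_B.+1) => rho ^+ m))/=.
  by rewrite big_const card_bool/= addr0 mulr_natl mulr2n.
rewrite ler_pM2l// -[leRHS]mul1r ler_pdivlMr ?subr_gt0// mulrC.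
have -> : (1 - rho) * \sum_(m < B.+1) rho ^+ m = 1 - rho ^+ B.+1.
  by rewrite -[RHS]opprB subrX1 -mulNr opprB.
by rewrite gerBl exprn_ge0.
Qed.

End Counting.

Section FrequencySum.
Variables (R : realType) (d r k n Q : nat) (alpha : 'I_r.+1 -> 'rV[R]_d).
Variables (q : 'rV[int]_d -> R) (c delta : R).
Hypotheses (c0 : 0 < c) (delta0 : 0 < delta) (k0 : (0 < k)%N) (Q0 : (0 < Q)%N).
Hypothesis q0 : forall h, 0 <= q h.
Hypothesis q_decay : forall h i,
  c * dist_int (dotp (Q%:Z *: h) (alpha i)) ^+ 2 <= 1 - q h.
Hypothesis delta_sep : forall h, h \in box d (n + n) -> h != 0 ->
  exists i, delta <= dist_int (dotp (Q%:Z *: h) (alpha i)).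

Let gain : R := c * k%:R * delta ^+ 2.

(** Every nonzero frequency has a coordinate of size at least [delta]: half
    of the exponent pays for the first factor. In the other half the maximum
    over the coordinates is bounded below by their average, which splits the
    exponential into the product required by [separated_sum_le]. *)
Lemma frequency_sum_le :
  \sum_(h <- box d n | h != 0) q h ^+ k <=
  expR (- (gain / 2)) * (2 / (1 - expR (- (gain / (2 * r.+1%:R))))) ^+ r.+1.
Proof.
have gain0 : 0 < gain by rewrite !mulr_gt0 ?ltr0n ?exprn_gt0.
pose z (h : 'rV[int]_d) i := centered (dotp (Q%:Z *: h) (alpha i)).
have r0 : 0 < r.+1%:R :> R by rewrite ltr0n.
set rho := expR (- (gain / (2 * r.+1%:R))).
have rho1 : rho < 1 by rewrite expR_lt1 oppr_lt0 divr_gt0// mulr_gt0.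
have nn : (n <= n + n)%N by exact: leq_addr.
have sep : {in box d n &, forall h h', h != h' -> exists i, delta <= `|z h i - z h' i|}.
  move=> h h' hn h'n hh'.
  have [||i di] := delta_sep (h := h - h').
  - rewrite mem_box; apply/forallP => j; rewrite !mxE.
    move: hn h'n; rewrite !mem_box => /forallP/(_ j) h1 /forallP/(_ j) h2.
    by apply: (le_trans (ler_normB _ _)); rewrite PoszD lerD.
  - by rewrite subr_eq0.
  exists i; apply: (le_trans di).
  rewrite scalerBr dotpDl dotpNl /z /centered.
  set u := dotp _ _; set v := dotp _ _; set m := Num.floor _; set m' := Num.floor _.
  have := dist_int_le (u - v) (m - m'); rewrite intrD mulrNz.
  by congr (_ <= `|_|); ring.
have zb h i : `|z h i| <= 1 / 2 by exact: norm_centered_le.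
have qk h i : q h ^+ k <= expR (- (c * k%:R * z h i ^+ 2)).
  have := q_decay h i; rewrite dist_intE real_normK ?num_real// -/(z h i) => qd.
  have : q h <= expR (- (c * z h i ^+ 2)).
    by apply: le_trans (expR_ge1Dx _); lra.
  move=> /(lerXn2r k); rewrite !nnegrE expR_ge0 q0 => /(_ isT isT) /le_trans; apply.
  by rewrite -expRM_natl; apply: eq_ler; congr expR; ring.
have term h : h \in box d n -> h != 0 ->
    q h ^+ k <= expR (- (gain / 2)) * \prod_i rho ^+ cell_index z delta h i.
  move=> hn h0.
  have [i0 i0P] := finite_argmin (fun i => - `|z h i|).
  have {}i0P j : `|z h j| <= `|z h i0| by have := i0P j; rewrite lerN2.
  apply: (le_trans (qk h i0)).
  have -> : \prod_i rho ^+ cell_index z delta h i =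
      expR (- (gain / (2 * r.+1%:R) * \sum_i (cell_index z delta h i)%:R)).
    rewrite -mulNr mulr_sumr expR_sum; apply: eq_bigr => i _.
    by rewrite mulrC expRM_natl.
  rewrite -expRD ler_expR.
  have d1 : delta ^+ 2 <= z h i0 ^+ 2.
    have [i] := delta_sep (box_le nn hn) h0; rewrite dist_intE => di.
    rewrite -[leRHS]real_normK ?num_real// ler_sqr ?nnegrE//; last exact: ltW.
    exact: le_trans (i0P i).
  have d2 i : delta ^+ 2 * (cell_index z delta h i)%:R <= z h i0 ^+ 2.
    have /andP[l _] := cell_indexP z delta0 h i.
    rewrite -[leRHS]real_normK ?num_real//.
    apply: (@le_trans _ _ (((cell_index z delta h i)%:R * delta) ^+ 2)); last first.
      rewrite ler_sqr ?nnegrE// ?mulr_ge0 ?(ltW delta0)//.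
      exact: le_trans (i0P i).
    rewrite exprMn mulrC ler_wpM2r ?sqr_ge0// -natrX ler_nat.
    by case: (cell_index _ _ _ _) => // m; rewrite expnS leq_pmulr.
  have d3 : delta ^+ 2 * \sum_i (cell_index z delta h i)%:R <= r.+1%:R * z h i0 ^+ 2.
    rewrite mulr_sumr (le_trans (ler_sum _ (fun i _ => d2 i)))//.
    by rewrite sumr_const card_ord mulr_natl.
  have ck : 0 < c * k%:R by rewrite mulr_gt0 ?ltr0n.
  move: d1 d3; move: (\sum_i _) (z h i0 ^+ 2) => S Z d1 d3.
  have e1 : gain <= c * k%:R * Z by rewrite ler_pM2l.
  have e2 : gain * S / r.+1%:R <= c * k%:R * Z.
    have : c * k%:R * (delta ^+ 2 * S) <= c * k%:R * (r.+1%:R * Z) by rewrite ler_pM2l.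
    have -> : c * k%:R * (delta ^+ 2 * S) = gain * S by rewrite /gain mulrA.
    by rewrite ler_pdivrMr// -[X in _ -> _ <= X]mulrA (mulrC Z).
  have -> : gain / (2 * r.+1%:R) * S = gain * S / r.+1%:R / 2 by field; rewrite gt_eqF.
  by move: (gain * S / r.+1%:R) e2 e1; move: (gain) (c * k%:R * Z) => a b e; lra.
rewrite big_seq_cond.
apply: (@le_trans _ _ (\sum_(h <- box d n)
    expR (- (gain / 2)) * \prod_i rho ^+ cell_index z delta h i)).
  rewrite big_mkcond/=; apply: ler_sum => h _; case: ifP => [/andP[hn h0]|_].
    exact: term.
  by rewrite mulr_ge0 ?expR_ge0// prodr_ge0// => i _; rewrite exprn_ge0// expR_ge0.
rewrite -mulr_sumr ler_wpM2l ?expR_ge0//.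
by apply: separated_sum_le => //; [exact: box_uniq|exact: expR_ge0].
Qed.

End FrequencySum.

(** * Diophantine condition, scales and the final estimate *)

Section DecayConstants.
Variables (R : realType) (r : nat).
Variables (lawxi : 'I_r.+1 -> probability int R) (lawI : probability 'I_r.+1 R).

(** Two atoms are chosen for each law before any random variable is given,
    so that the constants depend on the laws only. *)
Lemma step_decay_constants :
  (forall i, exists a, exists b,
    [/\ a != b, (0 < lawxi i [set a])%E & (0 < lawxi i [set b])%E]) ->
  (forall i, (0 < lawI [set i])%E) ->
  exists c : R, exists Q : nat, [/\ 0 < c, (0 < Q)%N &
    forall (disp : measure_display) (Omega : measurableType disp)
      (P : probability Omega R) (d : nat) (alpha : 'I_r.+1 -> 'rV[R]_d)
      (xi : 'I_r.+1 -> {RV P >-> int}) (I : {RV P >-> 'I_r.+1}),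
      independent_family xi I ->
      (forall i : 'I_r.+1, distribution P (xi i) =1 lawxi i) ->
      distribution P I =1 lawI ->
      forall (h : 'rV[int]_d) i, c * dist_int (dotp (Q%:Z *: h) (alpha i)) ^+ 2 <=
        1 - fourier_sq (distribution P (random_step alpha xi I)) h].
Proof.
move=> /choice[a /choice[b ab]] pI.
pose Q := (\prod_i `|a i - b i|%N)%N.
have Q0 : (0 < Q)%N.
  by apply: prodn_gt0 => i; case: (ab i) => abi _ _; rewrite absz_gt0 subr_eq0.
pose C i : R := 8 * (fine (lawI [set i]) ^+ 2 *
    fine (lawxi i [set a i]) * fine (lawxi i [set b i])) / Q%:R ^+ 2.
have fine0 dsp (T : measurableType dsp) (m : probability T R) A :
    measurable A -> (0 < m A)%E -> 0 < fine (m A).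
  by move=> mA m0; rewrite fine_gt0// m0/= ltey_eq fin_num_measure.
have C0 i : 0 < C i.
  have [_ ai bi] := ab i.
  by rewrite divr_gt0 ?exprn_gt0 ?ltr0n// !mulr_gt0// ?exprn_gt0//; exact: fine0.
have [i0 i0P] := finite_argmin C.
exists (C i0), Q; split=> // disp Omega P d alpha xi I ind xiE IE h i.
have [abi _ _] := ab i.
apply: (@le_trans _ _ (C i * dist_int (dotp (Q%:Z *: h) (alpha i)) ^+ 2)).
  by rewrite ler_wpM2r ?sqr_ge0.
have := @step_fourier_decay _ _ _ _ _ _ alpha xi I ind i (a i) (b i) Q h abi.
rewrite IE !xiE; apply => //.
by rewrite /Q (bigD1 i)//= dvdn_mulr.
Qed.

End DecayConstants.

Section Diophantine.
Variables (R : realType) (d r : nat) (alpha : 'I_r.+1 -> 'rV[R]_d) (psi : R -> R).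
Hypothesis psi_gt0 : forall x, 1 <= x -> 0 < psi x.
Hypothesis psi_mono : forall x y, 1 <= x -> x <= y -> psi x <= psi y.

Lemma supnorm_ge1 (h : 'rV[int]_d) : h != 0 -> 1 <= supnorm h :> R.
Proof.
move=> h0; have [j hj] : exists j, h 0 j != 0.
  apply/existsP; apply: contraNT h0; rewrite negb_exists => /forallP h0.
  by apply/eqP/rowP => j; rewrite mxE; apply/eqP; rewrite -[_ == _]negbK.
apply: (bigmax_sup j) => //.
by rewrite -intr_norm -[1]/(1%:~R) ler_int -gtz0_ge1 normr_gt0.
Qed.

Lemma supnorm_box n (Q : nat) (h : 'rV[int]_d) : h \in box d n ->
  supnorm (Q%:Z *: h) <= (Q * n)%:R :> R.
Proof.
rewrite mem_box => /forallP hn; apply/bigmax_leP; split=> // j _.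
rewrite mxE intrM normrM -intr_norm natrM.
by rewrite ler_pM// -?intr_norm ?ler0z// -[n%:R]/(n%:Z%:~R) ler_int.
Qed.

(** The finite maximum in the definition is attained at some [i]. *)
Lemma diophantine_lower (h : 'rV[int]_d) : h != 0 ->
  exists i, diophantine_inf alpha psi <= dist_int (dotp h (alpha i)) * psi (supnorm h).
Proof.
move=> h0.
have [i _ iE] := eq_bigmax (x := 0) (ord0 : 'I_r.+1) xpredT
  (fun i => dist_int (dotp h (alpha i))) isT (fun i _ => dist_int_ge0 _).
exists i; rewrite -iE; apply: ge_inf; last by exists h.
exists 0 => _ [h' /= h'0 <-]; apply: mulr_ge0.
  by apply: bigmax_ge_id.
by rewrite ltW// psi_gt0// supnorm_ge1.
Qed.

Lemma diophantine_box K n (Q : nat) : diophantine_inf alpha psi = K -> 0 < K ->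
  (0 < Q)%N -> (0 < n)%N -> forall h, h \in box d n -> h != 0 ->
  exists i, K / psi (Q * n)%:R <= dist_int (dotp (Q%:Z *: h) (alpha i)).
Proof.
move=> KE K0 Q0 n0 h hn h0.
have Qh0 : Q%:Z *: h != 0.
  apply: contraNneq h0 => /rowP E; apply/eqP/rowP => j; have := E j; rewrite !mxE.
  by move/eqP; rewrite mulf_eq0 => /orP[/eqP|/eqP//]; case: (Q) Q0.
have [i] := diophantine_lower Qh0; rewrite KE => Ki; exists i.
have s1 := supnorm_ge1 Qh0.
have Qn1 : 1 <= (Q * n)%:R :> R by rewrite ler1n muln_gt0 Q0.
rewrite ler_pdivrMr ?psi_gt0//; apply: (le_trans Ki).
by rewrite ler_wpM2l ?dist_int_ge0// psi_mono// supnorm_box.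
Qed.

End Diophantine.

Section GeneralizedInverse.
Variables (R : realType) (d r : nat) (psi : R -> R).
Hypothesis d_gt0 : (0 < d)%N.
Hypothesis psi_gt0 : forall x, 1 <= x -> 0 < psi x.
Hypothesis psi_mono : forall x y, 1 <= x -> x <= y -> psi x <= psi y.
Hypothesis psi_growth : forall x y, 1 <= x -> x <= y ->
  psi x * x `^ (- (d%:R / r.+1%:R)) <= psi y * y `^ (- (d%:R / r.+1%:R)).

(** [p] is (y / x)^(d / r.+1). Only this inequality on its integer power is
    used afterwards, which confines real exponents to this lemma. *)
Lemma psi_ratio x y : 1 <= x -> x <= y ->
  exists p, [/\ 1 <= p, y / x <= p ^+ r.+1 & psi x * p <= psi y].
Proof.
move=> x1 xy; have x0 : 0 < x by apply: lt_le_trans x1.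
have y0 : 0 < y by apply: lt_le_trans xy.
have r0 : 0 < r.+1%:R :> R by rewrite ltr0n.
have yx1 : 1 <= y / x by rewrite ler_pdivlMr// mul1r.
have yx0 : 0 <= y / x by apply: le_trans yx1.
exists ((y / x) `^ (d%:R / r.+1%:R)); split.
- have dr : 0 <= d%:R / r.+1%:R :> R by rewrite divr_ge0.
  by have := ler_powR yx1 dr; rewrite powRr0.
- rewrite -powR_mulrn ?powR_ge0// -powRrM divfK ?gt_eqF// powR_mulrn//.
  by case: (d) d_gt0 => // d' _; rewrite exprS ler_peMr// exprn_ege1.
- have := psi_growth x1 xy; rewrite !powRN.
  have xV e : x^-1 `^ e = (x `^ e)^-1.
    by rewrite -(powR_inv1 (ltW x0)) powRAC powR_inv1// powR_ge0.
  rewrite powRM ?invr_ge0 ?(ltW x0) ?(ltW y0)// xV ler_pdivlMr ?powR_gt0//.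
  by move=> H; apply: le_trans H; apply: eq_ler; ring.
Qed.

(** The growth condition forces [psi] to infinity; on an unbounded set the
    supremum would be a default value. *)
Lemma gen_inverse_has_sup s : has_sup (1 |` [set x | 1 <= x /\ psi x <= s]).
Proof.
split; first by exists 1; left.
exists (Num.max 1 ((s / psi 1) ^+ r.+1)) => x [->|[x1 xs]]; first by rewrite le_max lexx.
rewrite le_max; apply/orP; right.
have [p [p1]] := psi_ratio (lexx 1) x1; rewrite divr1 => xp ps.
apply: (le_trans xp); apply: lerXn2r; rewrite ?nnegrE.
- exact: le_trans p1.
- by rewrite divr_ge0 ?(ltW (psi_gt0 _))// (le_trans _ xs)// ltW// psi_gt0.
by rewrite ler_pdivlMr ?psi_gt0// mulrC (le_trans ps).
Qed.

Lemma gen_inverse_ge1 s : 1 <= gen_inverse psi s.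
Proof. by apply: ub_le_sup; [exact: (gen_inverse_has_sup s).2|left]. Qed.

Lemma gen_inverse_psi_le s x : 1 <= x -> x < gen_inverse psi s -> psi x <= s.
Proof.
move=> x1 xs; have e0 : 0 < gen_inverse psi s - x by rewrite subr_gt0.
have [y [->|[y1 ys]]] := sup_adherent e0 (gen_inverse_has_sup s).
  rewrite -/(gen_inverse psi s) subKr => ?; lra.
rewrite -/(gen_inverse psi s) subKr => xy.
by apply: le_trans ys; apply: psi_mono => //; exact: ltW.
Qed.

End GeneralizedInverse.

Lemma expRN_le_inv_pow (R : realType) (a u : R) (n : nat) : 0 < a -> 0 < u ->
  expR (- (a * u)) <= n.+1`!%:R / a ^+ n.+1 / u ^+ n.+1.
Proof.
move=> a0 u0; have au0 : 0 <= a * u by rewrite mulr_ge0// ltW.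
have F0 : 0 < n.+1`!%:R :> R by rewrite ltr0n fact_gt0.
rewrite expRN ler_pdivlMr ?exprn_gt0// ler_pdivlMr ?exprn_gt0// -mulrA -exprMn.
rewrite ler_pdivrMl ?expR_gt0// (mulrC u) -ler_pdivrMr//.
by apply: le_trans (expR_ge1Dxn n au0); rewrite lerDr.
Qed.

Section ScaleSum.
Variables (R : realType) (d r : nat).
Hypothesis d_gt0 : (0 < d)%N.
Variables (c K : R) (Q : nat).
Hypotheses (c0 : 0 < c) (K0 : 0 < K) (Q0 : (0 < Q)%N).

(** The first factor is the price of trading an exponential for a power,
    the second one is the series of [separated_sum_le] at the least possible
    gain. *)
Definition energy_const : R :=
  (2 * r.+1)`!%:R / (c * K ^+ 2 / 2) ^+ (2 * r.+1) *
  (2 / (1 - expR (- (c * K ^+ 2 / (2 * r.+1%:R))))) ^+ r.+1.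

Variables (k : nat) (alpha : 'I_r.+1 -> 'rV[R]_d) (psi : R -> R).
Variables (mu nu : probability (torus R d) R).
Hypothesis k0 : (0 < k)%N.
Hypothesis psi_gt0 : forall x, 1 <= x -> 0 < psi x.
Hypothesis psi_mono : forall x y, 1 <= x -> x <= y -> psi x <= psi y.
Hypothesis psi_growth : forall x y, 1 <= x -> x <= y ->
  psi x * x `^ (- (d%:R / r.+1%:R)) <= psi y * y `^ (- (d%:R / r.+1%:R)).
Hypothesis KE : diophantine_inf alpha psi = K.
Hypothesis decay : forall (h : 'rV[int]_d) i,
  c * dist_int (dotp (Q%:Z *: h) (alpha i)) ^+ 2 <= 1 - fourier_sq nu h.
Hypothesis mu_haar : is_haar mu.

Lemma energy_const_ge0 : 0 <= energy_const.
Proof.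
have cK0 : 0 < c * K ^+ 2 by rewrite mulr_gt0// exprn_gt0.
rewrite mulr_ge0 ?divr_ge0 ?exprn_ge0// ?divr_ge0// ?(ltW cK0)//.
by rewrite subr_ge0 expR_le1 oppr_le0 divr_ge0// ltW.
Qed.

(** The exponential decay in (x / y)^(2 d / r.+1), with y = 2 Q n, is weakened
    to the fourth power of y / x, whose square root is still summable over
    dyadic scales. *)
Lemma energy_le n x : (0 < n)%N -> (Q * (n + n))%:R <= x -> psi x <= Num.sqrt k%:R ->
  energy (torus_conv_pow nu k) n <= energy_const * ((Q * (n + n))%:R / x) ^+ 4.
Proof.
move=> n0; set y := (Q * (n + n))%:R => yx psix.
have y1 : 1 <= y by rewrite ler1n muln_gt0 Q0 addn_gt0 n0.
have y0 : 0 < y by apply: lt_le_trans y1.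
have x0 : 0 < x by apply: lt_le_trans yx.
have [p [p1 xp pk]] := psi_ratio d_gt0 psi_growth y1 yx.
have p0 : 0 < p by apply: lt_le_trans p1.
have cK0 : 0 < c * K ^+ 2 by rewrite mulr_gt0// exprn_gt0.
have r0 : 0 < r.+1%:R :> R by rewrite ltr0n.
pose delta := K / psi y.
have delta0 : 0 < delta by rewrite divr_gt0// psi_gt0.
have n00 : (0 < n + n)%N by rewrite addn_gt0 n0.
have sep := diophantine_box psi_gt0 psi_mono KE K0 Q0 n00.
have F := frequency_sum_le c0 delta0 k0 (fourier_sq_ge0 nu) decay sep.
have gain_ge : c * K ^+ 2 * p ^+ 2 <= c * k%:R * delta ^+ 2.
  have -> : c * k%:R * delta ^+ 2 = c * K ^+ 2 * (k%:R / psi y ^+ 2).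
    by rewrite /delta expr_div_n; ring.
  rewrite ler_pM2l// ler_pdivlMr ?exprn_gt0 ?psi_gt0// -exprMn mulrC.
  rewrite -[leRHS]sqr_sqrtr// ler_sqr ?nnegrE ?sqrtr_ge0//.
    exact: le_trans psix.
  by rewrite mulr_ge0// ltW// psi_gt0.
have gain_ge' : c * K ^+ 2 <= c * k%:R * delta ^+ 2.
  by apply: le_trans gain_ge; rewrite ler_peMr ?(ltW cK0)// exprn_ege1.
rewrite /energy.
under eq_bigr do rewrite fourier_sq_conv_pow.
apply: (le_trans F); rewrite /energy_const [X in _ <= X]mulrAC; apply: ler_pM.
- exact: expR_ge0.
- rewrite exprn_ge0// divr_ge0// subr_ge0 expR_le1 oppr_le0 divr_ge0//.
  by apply: le_trans gain_ge'; exact: ltW.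
- have a0 : 0 < c * K ^+ 2 / 2 by rewrite divr_gt0.
  apply: (@le_trans _ _ (expR (- (c * K ^+ 2 / 2 * p ^+ 2)))).
    by rewrite ler_expR lerN2 [X in X <= _]mulrAC ler_pM2r.
  have := expRN_le_inv_pow (2 * r.+1).-1 a0 (exprn_gt0 2 p0).
  rewrite prednK ?muln_gt0// => /le_trans; apply.
  apply: ler_wpM2l; first by rewrite divr_ge0 ?exprn_ge0// ltW.
  have -> : (y / x) ^+ 4 = ((x / y) ^+ 4)^-1 by rewrite -exprVn invf_div.
  have xy0 : 0 < x / y by rewrite divr_gt0.
  rewrite lef_pV2 ?posrE ?exprn_gt0//.
  have -> : (p ^+ 2) ^+ (2 * r.+1) = (p ^+ r.+1) ^+ 4.
    by rewrite -!exprM mulnA mulnC.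
  by apply: lerXn2r; rewrite ?nnegrE ?(ltW xy0) ?exprn_ge0// ltW.
- apply: lerXn2r; rewrite ?nnegrE.
  + rewrite divr_ge0// subr_ge0 expR_le1 oppr_le0 divr_ge0//.
    by apply: le_trans gain_ge'; exact: ltW.
  + by rewrite divr_ge0// subr_ge0 expR_le1 oppr_le0 divr_ge0// ltW.
  rewrite ler_pM2l// lef_pV2 ?posrE.
  + by rewrite lerD2l lerN2 ler_expR lerN2 ler_pM2r// invr_gt0 mulr_gt0.
  + by rewrite subr_gt0 expR_lt1 oppr_lt0 divr_gt0 ?(lt_le_trans cK0 gain_ge') ?mulr_gt0.
  + by rewrite subr_gt0 expR_lt1 oppr_lt0 divr_gt0 ?mulr_gt0.
Qed.

Lemma dyadic_scale (x : R) : exists L : nat,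
  ((0 < L)%N -> (2 ^ L * (2 * Q))%:R <= x) /\ x < (2 ^ L.+1 * (2 * Q))%:R.
Proof.
pose p L := x < (2 ^ L.+1 * (2 * Q))%:R.
have pex : exists L, p L.
  exists (Num.truncn x); rewrite /p; apply: (lt_le_trans (truncnS_gt x)); rewrite ler_nat.
  apply: (@leq_trans (2 ^ (Num.truncn x).+1)); first exact: ltnW (ltn_expl _ _).
  by rewrite leq_pmulr// muln_gt0.
have [L pL Lmin] := ex_minnP pex; exists L; split=> //.
case: L {pL} Lmin => // L Lmin _; rewrite leNgt; apply/negP => pL.
by have := Lmin L pL; rewrite ltnn.
Qed.

(** The scale is X / 2 rather than X, because the supremum X that defines the
    generalized inverse need not be attained. *)
Lemma wasserstein_conv_pow_le :
  (wasserstein1 (torus_conv_pow nu k) mu <=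
    (d.+1%:R * (16 * Q%:R + 32 * Num.sqrt energy_const * Q%:R) /
      gen_inverse psi (Num.sqrt k%:R))%:E)%E.
Proof.
set X := gen_inverse _ _; set G := Num.sqrt energy_const.
have G0 : 0 <= G by exact: sqrtr_ge0.
have X1 : 1 <= X by exact: (gen_inverse_ge1 d_gt0 psi_gt0 psi_growth).
pose x := X / 2; have x0 : 0 < x by rewrite /x; lra.
have QR : 0 < Q%:R :> R by rewrite ltr0n.
have Q1 : 1 <= Q%:R :> R by rewrite ler1n.
have [L [Lx xL]] := dyadic_scale x.
apply: (le_trans (berry_esseen_smoothing mu_haar _ L)); rewrite lee_fin.
rewrite -mulrA ler_wpM2l//.
have -> : (16 * Q%:R + 32 * G * Q%:R) / X = 8 * Q%:R / x + 16 * G * Q%:R / x.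
  by rewrite /x; field; rewrite gt_eqF//; apply: lt_le_trans X1.
apply: lerD.
  rewrite ler_pdivlMr// mulrAC ler_pdivrMr ?ltr0n ?expn_gt0//.
  by move: xL; rewrite expnS !natrM; lra.
have term l : (l < L)%N -> 2 / (2 ^ l)%:R *
    Num.sqrt (energy (torus_conv_pow nu k) (2 ^ l.+1)) <=
    32 * G * Q%:R ^+ 2 / x ^+ 2 * (2 ^ l)%:R.
  move=> lL.
  have L0 : (0 < L)%N by apply: leq_trans lL.
  (* Differences of frequencies in the box of radius 2 ^ (l + 1) have twice that size. *)
  have yx : (Q * (2 ^ l.+1 + 2 ^ l.+1))%:R <= x.
    apply: le_trans (Lx L0); rewrite ler_nat addnn -mul2n mulnA (mulnC Q) mulnC.
    by rewrite leq_pmul2r ?muln_gt0// leq_exp2l.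
  have x1 : 1 <= x.
    by apply: le_trans yx; rewrite ler1n muln_gt0 Q0 addn_gt0 expn_gt0.
  have px : psi x <= Num.sqrt k%:R.
    apply: (gen_inverse_psi_le d_gt0 psi_gt0 psi_mono psi_growth) => //.
    by rewrite -/X /x; lra.
  have n0 : (0 < 2 ^ l.+1)%N by rewrite expn_gt0.
  have := ler_wsqrtr (energy_le n0 yx px).
  rewrite sqrtrM ?energy_const_ge0// -/G (exprM _ 2 2) sqrtr_sqr ger0_norm ?sqr_ge0//.
  rewrite (_ : (Q * (2 ^ l.+1 + 2 ^ l.+1))%:R = 4 * Q%:R * (2 ^ l)%:R :> R); last first.
    by rewrite natrM addnn -mul2n expnS !natrM; ring.
  have l0 : 0 < (2 ^ l)%:R :> R by rewrite ltr0n expn_gt0.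
  move=> sq; apply: (@le_trans _ _ (2 / (2 ^ l)%:R * (G * (4 * Q%:R * (2 ^ l)%:R / x) ^+ 2))).
    by rewrite ler_wpM2l// divr_ge0.
  by apply: eq_ler; field; rewrite !gt_eqF.
have partial m : (m <= L)%N -> \sum_(l < m) 2 / (2 ^ l)%:R *
    Num.sqrt (energy (torus_conv_pow nu k) (2 ^ l.+1)) <=
    32 * G * Q%:R ^+ 2 / x ^+ 2 * ((2 ^ m)%:R - 1).
  elim: m => [_|m IH mL]; first by rewrite big_ord0 subrr mulr0.
  rewrite big_ord_recr/=; apply: (le_trans (lerD (IH (ltnW mL)) (term m mL))).
  by rewrite -mulrDr expnS natrM; apply: eq_ler; ring.
apply: (le_trans (partial L (leqnn _))).
have [->|L0] := posnP L; first by rewrite subrr mulr0 divr_ge0 ?(ltW x0)// !mulr_ge0.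
have := Lx L0; rewrite !natrM => LQ.
rewrite (_ : 16 * G * Q%:R / x = 32 * G * Q%:R ^+ 2 / x ^+ 2 * (x / (2 * Q%:R))); last first.
  by field; rewrite !gt_eqF.
apply: ler_wpM2l; first by rewrite divr_ge0 ?sqr_ge0// !mulr_ge0 ?sqr_ge0.
by rewrite ler_pdivlMr ?mulr_gt0//; apply: le_trans LQ; rewrite ler_pM2r ?mulr_gt0//; lra.
Qed.

End ScaleSum.

Theorem theorem6 (R : realType) (d r : nat) (d_gt0 : (0 < d)%N)
    (lawxi : 'I_r.+1 -> probability int R) (lawI : probability 'I_r.+1 R)
    (K : R) (K_gt0 : 0 < K) :
  exists2 C : R, 0 < C &
  forall (disp : measure_display) (Omega : measurableType disp)
    (P : probability Omega R)
    (xi : 'I_r.+1 -> {RV P >-> int}) (I : {RV P >-> 'I_r.+1})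
    (alpha : 'I_r.+1 -> 'rV[R]_d) (psi : R -> R) (mu : probability (torus R d) R),
  independent_family xi I ->
  (forall i : 'I_r.+1, distribution P (xi i) =1 lawxi i) ->
  distribution P I =1 lawI ->
  (forall i : 'I_r.+1, ~ exists n : int, {ae P, forall w, xi i w = n}) ->
  (forall i : 'I_r.+1, (0 < P [set w | I w = i])%E) ->
  (forall x : R, 1 <= x -> 0 < psi x) ->
  (forall x y : R, 1 <= x -> x <= y -> psi x <= psi y) ->
  (forall x y : R, 1 <= x -> x <= y ->
    psi x * x `^ (- (d%:R / r.+1%:R)) <= psi y * y `^ (- (d%:R / r.+1%:R))) ->
  diophantine_inf alpha psi = K ->
  is_haar mu ->
  forall k : nat, (0 < k)%N ->
  (wasserstein1 (torus_conv_pow (distribution P (random_step alpha xi I)) k) mu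
    <= (C / gen_inverse psi (Num.sqrt k%:R))%:E)%E.
Proof.
have [[atoms posI]|degenerate] := pselect
    ((forall i, exists a, exists b,
        [/\ a != b, (0 < lawxi i [set a])%E & (0 < lawxi i [set b])%E]) /\
     (forall i, (0 < lawI [set i])%E)); last first.
  (* Degenerate laws contradict the hypotheses, so any constant will do. *)
  exists 1 => // disp Omega P xi I alpha psi mu ind xiE IE nondeg Ipos.
  case: degenerate; split=> i; last by rewrite -IE; exact: Ipos.
  apply: two_atoms => n xi0; apply: (nondeg i); exists n.
  exists (xi i @^-1` (~` [set n])); split=> //; last by rewrite -xi0 -xiE.
  by rewrite -[X in measurable X]setTI; exact: measurable_funPT.
have [c [Q [c0 Q0 decay]]] := step_decay_constants atoms posI.
exists (d.+1%:R * (16 * Q%:R + 32 * Num.sqrt (energy_const r c K) * Q%:R)).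
  by rewrite mulr_gt0// ltr_pwDl ?mulr_gt0 ?ltr0n// !mulr_ge0// sqrtr_ge0.
move=> disp Omega P xi I alpha psi mu ind xiE IE _ _ psi_gt0 psi_mono psi_growth KE haar k k0.
exact: wasserstein_conv_pow_le (decay _ _ _ _ alpha _ _ ind xiE IE) haar.
Qed.
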